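(* Let $A:[0,1]\to\mathbb{R}$ be continuous with $A(0)=A(1)=0$, $A\not\equiv0$. Let $\theta_n\in(0,1)$, $\theta_n\to0$, be such that $F_n(t)=t+\theta_nA(t)$, $t\in(0,1)$, are distribution functions, and let $\kappa_n\in(0,1/2)$, $\kappa_n\to0$. Put $$m_n=\sup_{\kappa_n\le t\le1-\kappa_n}\frac{|A(t)|}{\sqrt{t(1-t)}}$$ and let $t_n$ be any point at which this supremum is attained. Suppose that $m_n\to\infty$, that $t_n\to0$ or $t_n\to1$, and that $\liminf_{n\to\infty}n\kappa_n/\log^2n>0$, $\lim_{n\to\infty}\log\kappa_n/\log n<0$, $n\theta_n^2/\log\log(1/\kappa_n)\to\infty$ and $\theta_n^2m_n^2/\kappa_n\to0$. Then the weak intermediate efficiency $\hat e_{\mathcal{E}\mathcal{K}}$ of $\mathcal{E}_n=\mathcal{E}_n(\kappa_n)$ with respect to $\mathcal{K}_n$ under $\{P_{\theta_n}\}$ satisfies $$\hat e_{\mathcal{E}\mathcal{K}}=\lim_{n\to\infty}\frac{c_{\mathcal{E}}[b_{\mathcal{E}}(P_{\theta_n}^n)]^2}{c_{\mathcal{K}}[b_{\mathcal{K}}(P_{\theta_n}^n)]^2}=\lim_{n\to\infty}\frac{m_n^2}{4\|A\|_\infty^2}=+\infty ,$$ where $\|A\|_\infty=\sup_{0<t<1}|A(t)|$.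
   Context: $P_{\theta_n}$ is the distribution on $(0,1)$ with distribution function $F_n$, $P_0$ the uniform distribution on $(0,1)$; $P_{\theta_n}^n,P_0^n$ are $n$-fold products. $\hat F_n$ is the empirical distribution function of $n$ i.i.d. observations, and $$\mathcal{K}_n=\sqrt n\sup_{0<t<1}|\hat F_n(t)-t|,\qquad \mathcal{E}_n(\kappa_n)=\sqrt n\sup_{\kappa_n\le t\le1-\kappa_n}\frac{|\hat F_n(t)-t|}{\sqrt{t(1-t)}} .$$ Intermediate slope: if, for a statistic $\mathcal{T}_n$, (a) $-\frac{1}{nw_n^2}\log P_0^n(\mathcal{T}_n\ge\sqrt n w_n)\to c_{\mathcal{T}}>0$ for all positive sequences $\{w_n\}$ in a given class $W$, and (b) $\mathcal{T}_n/b_{\mathcal{T}}(P_{\theta_n}^n)\to1$ in $P_{\theta_n}^n$-probability, where $\{b_{\mathcal{T}}(P_{\theta_n}^n)/\sqrt n\}\in W$, then $c_{\mathcal{T}}[b_{\mathcal{T}}(P_{\theta_n}^n)]^2$ is called the intermediate slope of $\mathcal{T}_n$ under $\{P_{\theta_n}\}$. For $\mathcal{K}_n$, $W$ consists of all $w_n\to0$ with $nw_n^2\to\infty$, $c_{\mathcal{K}}=2$ and $b_{\mathcal{K}}(P_{\theta_n}^n)=\sqrt n\theta_n\|A\|_\infty$. For $\mathcal{E}_n$, $W$ consists of all $w_n\to0$ with $w_n=o(\sqrt{\kappa_n})$ and $nw_n^2/\log\log n\to\infty$, $c_{\mathcal{E}}=1/2$, and here $b_{\mathcal{E}}(P_{\theta_n}^n)=\sqrt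 n\theta_nm_n$. The weak intermediate efficiency $\hat e_{\mathcal{E}\mathcal{K}}$ is the limit, as $n\to\infty$, of the ratio of the intermediate slope of $\mathcal{E}_n$ to that of $\mathcal{K}_n$. *)

(* Defs.v *)
(* MathComp-Analysis *)
From HB Require Import structures.
From mathcomp Require Export all_boot all_order all_algebra.
From mathcomp Require Export all_classical all_reals all_analysis.
Export Order.TTheory GRing.Theory Num.Theory.
Export numFieldNormedType.Exports.

Set Implicit Arguments.
Unset Strict Implicit.
Unset Printing Implicit Defensive.

Local Open Scope classical_set_scope.
Local Open Scope ring_scope.

Definition cons_pair (T : Type) (n : nat) (x : T * n.-tuple T) : n.+1.-tuple T :=
  [tuple of x.1 :: x.2].

Lemma measurable_cons_pair (d : measure_display) (T : measurableType d)
    (n : nat) : measurable_fun [set: T * n.-tuple T] (@cons_pair T n).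
Proof.
exact: (measurable_cons (@measurable_fst _ _ T (n.-tuple T))
                        (@measurable_snd _ _ T (n.-tuple T))).
Qed.

HB.instance Definition _ (d : measure_display) (T : measurableType d)
  (n : nat) := isMeasurableFun.Build _ _ _ _ (@cons_pair T n)
  (@measurable_cons_pair d T n).

(* The n-fold product P^n: it is P \x P^(n-1) transported along the
   identification T * T^(n-1) = T^n. *)
Fixpoint prob_pow (d : measure_display) (T : measurableType d) (R : realType)
    (P : probability T R) (n : nat) : probability (n.-tuple T) R :=
  match n with
  | 0 => \d_([tuple] : 0.-tuple T)
  | m.+1 => distribution (P \x prob_pow P m)%E (@cons_pair T m)
  end.

(* For a sample of size n = 0 this is 0; only limits in n matter. *)
Definition ecdf (R : realType) (n : nat)
    (x : n.-tuple (measurableTypeR R)) (t : R) : R :=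
  (\sum_(i < n) ((tnth x i <= t)%R)%:R) / n%:R.

Definition supnorm01 (R : realType) (h : R -> R) : R :=
  sup [set `|h t| | t in `]0, 1[%classic].

Definition wsupnorm (R : realType) (k : R) (h : R -> R) : R :=
  sup [set `|h t| / Num.sqrt (t * (1 - t)) | t in `[k, 1 - k]%classic].

Definition statistic (R : realType) : Type :=
  forall n : nat, n.-tuple (measurableTypeR R) -> R.

Definition KS (R : realType) : statistic R := fun n x =>
  Num.sqrt n%:R * supnorm01 (fun t => ecdf x t - t).

Definition WKS (R : realType) (kappa : nat -> R) : statistic R := fun n x =>
  Num.sqrt n%:R * wsupnorm (kappa n) (fun t => ecdf x t - t).

Definition W_KS (R : realType) : set (nat -> R) :=
  [set w | w n @[n --> \oo] --> (0 : R) /\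
           n%:R * w n ^+ 2 @[n --> \oo] --> +oo].

Definition W_WKS (R : realType) (kappa : nat -> R) : set (nat -> R) :=
  [set w | [/\ w n @[n --> \oo] --> (0 : R),
               w n / Num.sqrt (kappa n) @[n --> \oo] --> (0 : R) &
               n%:R * w n ^+ 2 / ln (ln n%:R) @[n --> \oo] --> +oo]].

(* [P n] is the one-observation law under the n-th alternative, [c] the index
   of the statistic and [b] its asymptotic shift, so that the intermediate
   slope is [c * b n ^+ 2].  Members of [W] need not be positive for every n:
   positivity is only required in the deviation clause. *)
Record has_intermediate_slope (R : realType)
    (P0 : probability (measurableTypeR R) R)
    (P : nat -> probability (measurableTypeR R) R)
    (T : statistic R) (W : set (nat -> R)) (c : R) (b : nat -> R) : Prop := {
  slope_index_gt0 : 0 < c ;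
  slope_deviations : forall w : nat -> R, (forall n, 0 < w n) -> W w ->
    ((- (n%:R * w n ^+ 2)^-1)%:E *
      lne (prob_pow P0 n [set x | (Num.sqrt n%:R * w n <= T n x)%R]))%E
    @[n --> \oo] --> c%:E ;
  slope_lln : forall eps : R, 0 < eps ->
    prob_pow (P n) n [set x | eps <= `|T n x / b n - 1|]
    @[n --> \oo] --> 0%E ;
  slope_class : W (fun n => b n / Num.sqrt n%:R) }.

(* [e] is the weak intermediate efficiency of [T1] with respect to [T2]. *)
Definition has_weak_intermediate_efficiency (R : realType)
    (P0 : probability (measurableTypeR R) R)
    (P : nat -> probability (measurableTypeR R) R)
    (T1 : statistic R) (W1 : set (nat -> R)) (c1 : R) (b1 : nat -> R)
    (T2 : statistic R) (W2 : set (nat -> R)) (c2 : R) (b2 : nat -> R)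
    (e : \bar R) : Prop :=
  [/\ has_intermediate_slope P0 P T1 W1 c1 b1,
      has_intermediate_slope P0 P T2 W2 c2 b2 &
      ((c1 * b1 n ^+ 2) / (c2 * b2 n ^+ 2))%:E @[n --> \oo] --> e].

Definition has_df01 (R : realType) (P : probability (measurableTypeR R) R)
    (F : R -> R) : Prop :=
  P `]0, 1[%classic = 1%E /\
  forall t : R, t \in `]0, 1[ -> P `]-oo, t]%classic = (F t)%:E.

(* Main.v *)
From HB Require Import structures.
From mathcomp Require Import measurable_realfun ring lra.
Require Import Defs.
Set Implicit Arguments.
Unset Strict Implicit.
Unset Printing Implicit Defensive.
Local Open Scope classical_set_scope.
Local Open Scope ring_scope.

(** The comparison rests on three facts about each statistic, all of which
    come from exponential inequalities for the empirical process.

    Upper bounds.  For a law with distribution function F the process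
    (ecdf - F) / (1 - F) is a martingale in t, and (ecdf - F) / F is one when
    time is reversed.  Doob's inequality for exp (h times this martingale)
    therefore bounds the probability that the deviation becomes large anywhere
    on a block [a, b] by the Chernoff bound at a single point of it
    ([nested_deviation], [block_forward], [block_backward]).  The loss is only
    the ratio of the thresholds at a and b.  For the unweighted statistic
    finitely many blocks of equal length suffice; where F is about v the exponent
    is n * w ^ 2 / (2 * v * (1 - v)), which is at least 2 * n * w ^ 2, up to a
    factor close to 1 ([uniform_tail]).  For the weighted one the threshold is proportional to
    sqrt (t * (1 - t)), so every block has exponent close to n * w ^ 2 / 2; the
    blocks form a geometric progression from kappa to 1/2 (and its mirror
    image), there are of the order of log (1 / kappa) of them, and this number
    is negligible as soon as n * w ^ 2 dominates log log (1 / kappa)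
    ([weighted_tail], [weighted_tail_log]).  The condition that w is small
    compared with the square root of kappa keeps all Bernoulli variables in
    their Gaussian range.

    Lower bounds.  At the median both statistics are bounded below by a
    multiple of the deviation of a fair coin, whose probability is found by
    tilting the coin ([coin_lower], [null_lower]).  The exponents agree with
    the upper bounds, which gives the indices 2 and 1/2.

    Laws of large numbers.  The same tail bounds hold for every law with F
    close to the identity (in relative precision on [kappa, 1 - kappa] for the
    weighted statistic), in particular for F = t + theta * A; this relative
    closeness is what the smallness of theta * m compared with the square root
    of kappa provides.  Both statistics are norms of ecdf - t, so by the
    triangle inequality they differ from the norm of theta * A by at most the
    norm of ecdf - F, which is of smaller order ([KS_lln], [WKS_lln]).

    The ratio of the slopes is then m ^ 2 / (4 * N ^ 2) for all n > 0, where N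
    is the supremum norm of A, and it tends to infinity with m. *)

(** * A maximal inequality on finite product spaces *)

(** Summation over a product space by first fixing the image of every
    coordinate: this is conditioning on the information carried by [g]. *)
Lemma sum_prod_fiber (R : comRingType) (I J : finType) (n : nat)
    (g : I -> J) (F : I -> R) (B : pred {ffun 'I_n -> I}) (B' : pred {ffun 'I_n -> J}) :
  (forall c : {ffun 'I_n -> I}, B c = B' [ffun i => g (c i)]) ->
  \sum_(c | B c) \prod_(i < n) F (c i) =
  \sum_(d : {ffun 'I_n -> J} | B' d) \prod_(i < n) \sum_(v | g v == d i) F v.
Proof.
move=> BB'.
rewrite (partition_big (fun c : {ffun 'I_n -> I} => [ffun i => g (c i)]) B') /=;
  last by move=> c; rewrite BB'.
apply: eq_bigr => d B'd; rewrite bigA_distr_big_dep /=.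
apply: eq_bigl => c.
apply/andP/familyP => [[_ /eqP <-] i|Hc].
  by rewrite unfold_in ffunE eqxx.
have -> : [ffun i => g (c i)] = d.
  by apply/ffunP => i; rewrite ffunE; apply/eqP; exact: Hc.
by rewrite BB'; split => //; suff -> : [ffun i => g (c i)] = d;
  [|apply/ffunP => i; rewrite ffunE; apply/eqP; exact: Hc].
Qed.

Section finite_doob.
Variables (R : realType) (M n : nat) (p : 'I_M.+1 -> R).
Hypotheses (p_ge0 : forall v, 0 <= p v) (p_sum1 : \sum_v p v = 1).

Definition head_mass (k : nat) : R := \sum_(v : 'I_M.+1 | (v <= k)%N) p v.

Local Notation q := head_mass.

(** A cell is compared with [k] as an observation is with a point of the line;
    dividing by [1 - q k] makes these variables a martingale in [k]. *)
Definition centred_cell (k : nat) (v : 'I_M.+1) : R :=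
  ((v <= k)%N%:R - q k) / (1 - q k).

Local Notation xi := centred_cell.

Let qC k : \sum_(v : 'I_M.+1 | ~~ (v <= k)%N) p v = 1 - q k.
Proof.
by rewrite -p_sum1 [X in _ = X - _](bigID (fun v : 'I_M.+1 => (v <= k)%N)) /= addrAC subrr add0r.
Qed.

Let q_le k l : (k <= l)%N -> q k <= q l.
Proof.
move=> kl; rewrite /head_mass [leRHS](bigID (fun v : 'I_M.+1 => (v <= k)%N)) /=.
rewrite -[leLHS]addr0 lerD ?sumr_ge0//.
rewrite le_eqVlt; apply/orP; left; apply/eqP/eq_bigl => v.
by case: (leqP v k) => vk; rewrite ?andbF// andbT (leq_trans vk kl).
Qed.

Let tail_mean k m : (k <= m)%N -> q m < 1 ->
  \sum_(v : 'I_M.+1 | ~~ (v <= k)%N) p v * (xi m v + q k / (1 - q k)) = 0.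
Proof.
move=> km qm1; have qk1 := le_lt_trans (q_le km) qm1.
under eq_bigr do rewrite mulrDr.
rewrite big_split /= -mulr_suml qC.
have -> : \sum_(v : 'I_M.+1 | ~~ (v <= k)%N) p v * xi m v = - q k.
  rewrite /centred_cell; under eq_bigr do rewrite mulrA mulrBr.
  rewrite -mulr_suml sumrB -mulr_suml qC.
  have -> : \sum_(v : 'I_M.+1 | ~~ (v <= k)%N) p v * (v <= m)%N%:R = q m - q k.
    rewrite [q m](bigID (fun v : 'I_M.+1 => (v <= k)%N)) /=.
    have -> : \sum_(v : 'I_M.+1 | (v <= m)%N && (v <= k)%N) p v = q k.
      apply: eq_bigl => v; case: (leqP v k) => vk; rewrite ?andbF// andbT.
      by rewrite (leq_trans vk km).
    rewrite addrAC subrr add0r [RHS]big_mkcondl /=; apply: eq_bigr => v _.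
    by case: ifPn => _; rewrite ?mulr1 ?mulr0.
  by field; lra.
by field; lra.
Qed.

(** Jensen's inequality on the only fibre that is not a single cell, the one
    of all cells beyond [k]. *)
Let fiber_le h k m (d : 'I_M.+1) : (k <= m)%N -> q m < 1 ->
  \sum_(v : 'I_M.+1 | inord (minn v k.+1) == d) p v * expR (h * xi k v) <=
  \sum_(v : 'I_M.+1 | inord (minn v k.+1) == d) p v * expR (h * xi m v).
Proof.
move=> km qm1; have qk1 := le_lt_trans (q_le km) qm1.
have inordE (v : 'I_M.+1) : (inord (minn v k.+1) : 'I_M.+1) = minn v k.+1 :> nat.
  by rewrite inordK// (leq_ltn_trans (geq_minl _ _)).
have [dk|dk] := leqP d k.
  apply: ler_sum => v /eqP vd.
  have vk : (v <= k)%N.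
    by move: dk; rewrite -vd inordE geq_min ltnn orbF.
  by rewrite /centred_cell vk (leq_trans vk km) !divff// subr_eq0 gt_eqF.
have [dk1|dk1] := eqVneq (d : nat) k.+1; last first.
  have no (v : 'I_M.+1) : (inord (minn v k.+1) == d) = false.
    apply/negbTE/eqP => vd; move: dk dk1.
    rewrite -vd inordE /minn; case: (ltnP v k.+1) => [vk kv _|_ _ /eqP//].
    by rewrite ltnNge -ltnS vk in kv.
  by rewrite !big_pred0.
have predE (v : 'I_M.+1) : (inord (minn v k.+1) == d) = ~~ (v <= k)%N.
  rewrite -(inj_eq val_inj) /= inordE dk1 /minn; case: ltnP => [vk|vk].
    by rewrite -ltnS vk /= ltn_eqF.
  by rewrite eqxx -ltnNge vk.
rewrite !(eq_bigl _ _ predE) -subr_ge0 -sumrB.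
pose r := - (q k / (1 - q k)).
rewrite -[leLHS](mulr0 (h * expR (h * r))) -[X in _ * X <= _](tail_mean km qm1) mulr_sumr.
apply: ler_sum => v vk.
rewrite /(centred_cell k) (negbTE vk) sub0r mulNr -/r -mulrBr.
rewrite mulrCA ler_wpM2l// -[_ / _]opprK -/r.
have -> : expR (h * xi m v) = expR (h * r) * expR (h * (xi m v - r)).
  by rewrite -expRD; congr expR; ring.
rewrite -[X in _ <= _ - X]mulr1 -mulrBr -mulrA mulrCA ler_wpM2l ?expR_ge0//.
have := expR_ge1Dx (h * (xi m v - r)); lra.
Qed.

(** Given the cells clipped at [k], the conditional mean of the exponential at
    time [m] is at least its value at time [k]; summing over an event decided
    by the clipped cells preserves the inequality. *)
Let stop_le h k m (B : pred {ffun 'I_n -> 'I_M.+1}) : (k <= m)%N -> q m < 1 ->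
  (forall c : {ffun 'I_n -> 'I_M.+1}, B c = B [ffun i => inord (minn (c i) k.+1)]) ->
  \sum_(c | B c) \prod_(i < n) (p (c i) * expR (h * xi k (c i))) <=
  \sum_(c | B c) \prod_(i < n) (p (c i) * expR (h * xi m (c i))).
Proof.
move=> km qm1 HB.
pose g (v : 'I_M.+1) : 'I_M.+1 := inord (minn v k.+1).
rewrite (@sum_prod_fiber _ _ _ _ g (fun v => p v * expR (h * xi k v)) B B HB).
rewrite (@sum_prod_fiber _ _ _ _ g (fun v => p v * expR (h * xi m v)) B B HB).
apply: ler_sum => d _; apply: ler_prod => i _; apply/andP; split.
  by apply: sumr_ge0 => v _; rewrite mulr_ge0 ?expR_ge0.
exact: fiber_le.
Qed.

(** Doob's inequality: decompose by the first passage, and on each first-passage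
    event replace the exponential martingale by its last value. *)
Lemma finite_maximal (h y : R) (m : nat) : q m < 1 ->
  \sum_(c : {ffun 'I_n -> 'I_M.+1} |
        [exists k : 'I_m.+1, y <= h * \sum_(i < n) xi k (c i)])
    \prod_(i < n) p (c i) <=
  expR (- y) * (\sum_v p v * expR (h * xi m v)) ^+ n.
Proof.
move=> qm1.
pose H (k : nat) (c : {ffun 'I_n -> 'I_M.+1}) := y <= h * \sum_(i < n) xi k (c i).
pose B (k : nat) (c : {ffun 'I_n -> 'I_M.+1}) := H k c && [forall j : 'I_k, ~~ H j c].
have clipH j k (c : {ffun 'I_n -> 'I_M.+1}) : (j <= k)%N ->
    H j c = H j [ffun i => inord (minn (c i) k.+1)].
  move=> jk; rewrite /H; congr (y <= h * _); apply: eq_bigr => i _.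
  rewrite ffunE /centred_cell inordK ?(leq_ltn_trans (geq_minl _ _))//.
  congr ((_%:R - _) / _); by rewrite geq_min [(k < j)%N]ltnNge jk orbF.
have clipB k (c : {ffun 'I_n -> 'I_M.+1}) :
    B k c = B k [ffun i => inord (minn (c i) k.+1)].
  rewrite /B (clipH k k)//; congr andb.
  by apply: eq_forallb => j; rewrite (clipH j k)// ltnW.
(* the event is the disjoint union of the first-passage events B k *)
have -> : \sum_(c : {ffun 'I_n -> 'I_M.+1} |
        [exists k : 'I_m.+1, y <= h * \sum_(i < n) xi k (c i)])
    \prod_(i < n) p (c i) =
    \sum_(k < m.+1) \sum_(c | B k c) \prod_(i < n) p (c i).
  under [RHS]eq_bigr do rewrite big_mkcond.
  rewrite exchange_big /= [LHS]big_mkcond; apply: eq_bigr => c _.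
  case: ifPn => [/existsP[k0 Hk0]|/existsPn nH]; last first.
    rewrite big1// => k _; case: ifPn => // /andP[Hk _].
    by move: Hk; rewrite /H (negbTE (nH k)).
  have exH : exists k, H k c by exists k0.
  have [k Hk minH] := ex_minnP exH.
  have km : (k < m.+1)%N by apply: leq_ltn_trans (ltn_ord k0); exact: minH.
  have Bk : B k c.
    rewrite /B Hk; apply/forallP => j; apply/negP => Hj.
    by have := minH _ Hj; rewrite leqNgt ltn_ord.
  rewrite (bigD1 (Ordinal km))//= Bk [X in _ + X]big1 ?addr0// => l lk.
  case: ifPn => // /andP[Hl /forallP nH].
  have kl : (k < l)%N.
    rewrite ltn_neqAle minH// andbT; apply: contra lk => /eqP kl.
    by apply/eqP/val_inj.
  by have := nH (Ordinal kl); rewrite Hk.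
have -> : \sum_v p v * expR (h * xi m v) =
  \sum_(v | predT v) p v * expR (h * xi m v) by [].
rewrite -[n in X in _ <= _ * X]card_ord -prodr_const bigA_distr_bigA /=.
rewrite mulr_sumr.
apply: (@le_trans _ _ (\sum_(k < m.+1)
   expR (- y) * \sum_(c | B k c) \prod_(i < n) (p (c i) * expR (h * xi m (c i))))).
  apply: ler_sum => k _.
  have km : (k <= m)%N by rewrite -ltnS.
  apply: le_trans (ler_wpM2l (expR_ge0 _) (stop_le h km qm1 (clipB k))).
  rewrite mulr_sumr; apply: ler_sum => c /andP[Hk _].
  rewrite big_split /= mulrCA ler_peMr//; first exact: prodr_ge0.
  rewrite -(big_morph _ (@expRD R) (@expR0 R)) -expRD -expR0 ler_expR.
  by rewrite -mulr_sumr addrC subr_ge0.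
under eq_bigr do rewrite mulr_sumr big_mkcond.
rewrite exchange_big /=; apply: ler_sum => c _.
have [/existsP[k Bk]|/existsPn nB] := boolP [exists k : 'I_m.+1, B k c]; last first.
  by rewrite big1 => [|k _]; rewrite ?(negbTE (nB k))// mulr_ge0 ?expR_ge0//
     prodr_ge0// => i _; rewrite mulr_ge0 ?expR_ge0.
rewrite (bigD1 k)//= Bk [X in _ + X]big1 ?addr0// => l lk.
case: ifPn => // Bl; exfalso.
move: Bk Bl => /andP[Hk /forallP nHk] /andP[Hl /forallP nHl].
case: (ltngtP l k) => [lk'|kl'|/val_inj lk']; last by rewrite lk' eqxx in lk.
  by have := nHk (Ordinal lk'); rewrite Hl.
by have := nHl (Ordinal kl'); rewrite Hk.
Qed.

End finite_doob.

(** * Exponential moments and product laws *)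

Lemma expR_le_quad_npos (R : realType) (x : R) : x <= 0 ->
  expR x <= 1 + x + x ^+ 2 / 2.
Proof.
move=> x0; pose f (t : R) : R := 1 + t + t * t * 2^-1 - expR t.
pose df (t : R) : R := 1 + t - expR t.
have fE (t : R) : is_derive t 1 f (df t).
  apply: is_derive_eq; rewrite /df /GRing.scale /=.
  by field.
have cf : {within `[x, 0], continuous f}.
  by apply: continuous_subspaceT => t; apply/differentiable_continuous/derivable1_diffP.
have [c _] := MVT_segment x0 (fun t _ => fE t) cf.
have := expR_ge1Dx c; rewrite /df /f expR0; nra.
Qed.

Lemma expR_le_quad_nneg (R : realType) (x : R) : 0 <= x ->
  expR x <= 1 + x + x ^+ 2 / 2 * expR x.
Proof.
move=> x0; pose f (t : R) : R := 1 + t + t * t * 2^-1 * expR t - expR t.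
pose df (t : R) : R := 1 + t * expR t + t * t / 2 * expR t - expR t.
have fE (t : R) : is_derive t 1 f (df t).
  apply: is_derive_eq; rewrite /df /GRing.scale /=.
  by field.
have cf : {within `[0, x], continuous f}.
  by apply: continuous_subspaceT => t; apply/differentiable_continuous/derivable1_diffP.
have [c] := MVT_segment x0 (fun t _ => fE t) cf.
rewrite in_itv /= => /andP[c0 _].
have e1 : expR c * expR (- c) = 1 by exact: expRxMexpNx_1.
have e2 := expR_ge1Dx (- c).
have e3 := expR_gt0 c.
have : 0 <= df c.
  have := ler_wpM2l (ltW e3) e2; rewrite e1.
  have : 0 <= c * c / 2 * expR c by rewrite !mulr_ge0 ?expR_ge0.
  rewrite /df; lra.
rewrite /f expR0; nra.
Qed.

Lemma expR_le_quad (R : realType) (x : R) :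
  expR x <= 1 + x + x ^+ 2 / 2 * expR `|x|.
Proof.
have [x0|x0] := leP 0 x; first by rewrite ger0_norm ?expR_le_quad_nneg.
apply: le_trans (expR_le_quad_npos (ltW x0)) _; rewrite lerD2l ler_peMr//.
  by rewrite divr_ge0// sqr_ge0.
by rewrite -expR0 ler_expR.
Qed.

(** The variance proxy tends to the exact variance [q * (1 - q)] as [h] goes
    to 0; this is what makes the constants of the large deviations sharp. *)
Lemma bernoulli_mgf (R : realType) (q h : R) : 0 <= q <= 1 ->
  q * expR (h * (1 - q)) + (1 - q) * expR (- (h * q)) <=
  expR (h ^+ 2 * (q * (1 - q)) / 2 * expR `|h|).
Proof.
move=> /andP[q0 q1].
have aux (u : R) : `|u| <= 1 ->
    expR (h * u) <= 1 + h * u + (h * u) ^+ 2 / 2 * expR `|h|.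
  move=> u1; apply: le_trans (expR_le_quad _) _; rewrite lerD2l.
  rewrite ler_wpM2l ?divr_ge0 ?sqr_ge0// ler_expR normrM ler_piMr//.
have e1 := aux (1 - q) ltac:(rewrite ler_norml; lra).
have e2 := aux (- q) ltac:(rewrite ler_norml; lra).
rewrite -mulrN.
apply: le_trans (expR_ge1Dx _).
have {}e1 := ler_wpM2l q0 e1.
have q1' : 0 <= 1 - q by lra.
have {}e2 := ler_wpM2l q1' e2.
apply: le_trans (lerD e1 e2) _.
rewrite le_eqVlt; apply/orP; left; apply/eqP; by field.
Qed.

Section product_law.
Context {d : measure_display} {T : measurableType d} {R : realType}.
Variable P : probability T R.

Let fin_P (B : set T) : measurable B -> ((fine (P B))%:E = P B)%E.
Proof. by move=> mB; rewrite fineK// fin_num_measure. Qed.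

Lemma measurable_box (n : nat) (B : 'I_n -> set T) :
  (forall i, measurable (B i)) ->
  measurable [set x : n.-tuple T | forall i, B i (tnth x i)].
Proof.
move=> mB.
have -> : [set x : n.-tuple T | forall i, B i (tnth x i)] =
    \bigcap_(i in [set: 'I_n]) ((@tnth _ T ^~ i) @^-1` B i).
  by apply/seteqP; split => x /= Bx i; [move=> _; exact: Bx|exact: (Bx i I)].
apply: fin_bigcap_measurable => // i _.
by rewrite -[X in measurable X]setTI; exact: measurable_tnth.
Qed.

Lemma prob_pow_box (n : nat) (B : 'I_n -> set T) :
  (forall i, measurable (B i)) ->
  prob_pow P n [set x | forall i, B i (tnth x i)] =
  (\prod_(i < n) fine (P (B i)))%:E.
Proof.
elim: n B => [|n IH] B mB.
  rewrite big_ord0 /= /dirac indicE mem_set//= => i.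
  by case: i.
rewrite big_ord_recl EFinM fin_P//.
rewrite -(IH (fun i => B (lift ord0 i)))//.
rewrite -product_measure1E//; last exact: (@measurable_box _ (fun i => B (lift ord0 i))).
rewrite /= /distribution /pushforward; congr ((_ \x _)%E _).
apply/seteqP; split => [[a x] /= Bax|[a x] /= [Ba Bx] i].
  by split; [exact: (Bax ord0)|move=> i; have := Bax (lift ord0 i); rewrite tnthS].
by case: (unliftP ord0 i) => [j ->|->]; rewrite ?tnthS ?tnth0.
Qed.

Lemma law_fiber (I : finType) (f : T -> I) (Q : pred I) :
  (forall v, measurable (f @^-1` [set v])) ->
  measurable [set x | Q (f x)] /\
  (P [set x | Q (f x)] = (\sum_(v | Q v) fine (P (f @^-1` [set v])))%:E)%E.
Proof.
move=> mf.
have -> : [set x | Q (f x)] = \bigcup_(v in [set` Q]) (f @^-1` [set v]).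
  by apply/seteqP; split => [x /= Qx|x [v Qv] /= ->//]; exists (f x).
split; first exact: fin_bigcup_measurable.
rewrite measure_fin_bigcup//; last by move=> u v _ _ [x [/= <- <-]].
rewrite -(@bigfs _ _ _ _ (index_enum I))//; last first.
- by move=> v _; rewrite mem_index_enum.
- by rewrite index_enum_uniq.
rewrite -sumEFin; apply: eq_bigr => v _; by rewrite fin_P.
Qed.

End product_law.

(** Events that depend on each observation only through a finite-valued map
    reduce to sums over a finite product space. *)
Lemma prob_pow_cells (d : measure_display) (T : measurableType d) (R : realType)
    (P : probability T R) (n : nat) (I : finType) (f : T -> I)
    (Q : pred {ffun 'I_n -> I}) :
  (forall v, measurable (f @^-1` [set v])) ->
  measurable [set x : n.-tuple T | Q [ffun i => f (tnth x i)]] /\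
  (prob_pow P n [set x | Q [ffun i => f (tnth x i)]] =
   (\sum_(c | Q c) \prod_(i < n) fine (P (f @^-1` [set c i])))%:E)%E.
Proof.
move=> mf.
pose g (x : n.-tuple T) := [ffun i => f (tnth x i)].
have gE c : g @^-1` [set c] = [set x | forall i, (f @^-1` [set c i]) (tnth x i)].
  apply/seteqP; split => [x /= <- i|x /= H].
    by rewrite ffunE.
  by apply/ffunP => i; rewrite ffunE H.
have mg c : measurable (g @^-1` [set c]).
  by rewrite gE; exact: (@measurable_box _ _ _ (fun i => f @^-1` [set c i])). 
have [mQ PQ] := law_fiber (prob_pow P n) Q mg.
split; first exact: mQ.
rewrite [LHS]PQ; congr EFin; apply: eq_bigr => c _.
by rewrite gE (@prob_pow_box _ _ _ _ _ (fun i => f @^-1` [set c i])).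
Qed.

(** * Nested families of events *)

Section nested_events.
Context {d : measure_display} {T : measurableType d} {R : realType}.
Variables (P : probability T R) (m : nat) (E : nat -> set T).
Hypothesis mE : forall k, measurable (E k).
Hypothesis ndE : forall k l, (k <= l)%N -> (l <= m)%N -> E k `<=` E l.

Let q (k : nat) : R := fine (P (E k)).

(* the index of the first event that occurs, with m.+1 when none does *)
Let cell (x : T) : 'I_m.+2 := inord (find (fun k => x \in E k) (iota 0 m.+1)).

Let cell_le x k : (k <= m)%N -> (cell x <= k)%N = (x \in E k).
Proof.
move=> km; rewrite /cell inordK; last first.
  by rewrite ltnS (leq_trans (find_size _ _))// size_iota.
apply/idP/idP => [fk|xE].
  have hasE : has (fun k => x \in E k) (iota 0 m.+1).
    by rewrite has_find size_iota ltnS (leq_trans fk).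
  have := nth_find 0%N hasE; rewrite nth_iota ?add0n ?ltnS ?(leq_trans fk)//.
  by rewrite !inE; apply: ndE.
rewrite leqNgt; apply/negP => kf.
have := before_find 0%N kf; rewrite nth_iota ?add0n ?ltnS// => /negP; exact.
Qed.

Let cell_set k : [set x | (cell x <= k)%N] = if (k <= m)%N then E k else setT.
Proof.
case: ifPn => [km|]; last first.
  rewrite -ltnNge => mk; apply/seteqP; split => // x _ /=.
  by rewrite (leq_trans _ mk)// -ltnS.
by apply/seteqP; split => x /=; rewrite cell_le// ?inE// => xE; rewrite inE.
Qed.

Let measurable_cell v : measurable (cell @^-1` [set v]).
Proof.
have mle k : measurable [set x | (cell x <= k)%N].
  by rewrite cell_set; case: ifP.
have -> : cell @^-1` [set v] =
    [set x | (cell x <= v)%N] `\` (if v : nat is u.+1 then [set x | (cell x <= u)%N] else set0).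
  apply/seteqP; split => x /=.
    move=> xv; split; first by rewrite xv.
    by case vE : (v : nat) => [|u] //=; rewrite xv vE ltnn.
  case => xv nx; apply/val_inj/eqP; rewrite eqn_leq xv/=.
  by move: nx; case: (v : nat) => [|u] //= /negP; rewrite -ltnNge.
by apply: measurableD => //; case: (v : nat).
Qed.

Let p (v : 'I_m.+2) : R := fine (P (cell @^-1` [set v])).

Let p_sum1 : \sum_v p v = 1.
Proof.
have [_ H] := law_fiber P xpredT measurable_cell.
apply: EFin_inj; apply: etrans (esym H) _; rewrite -(probability_setT P).
by congr (P _); apply/seteqP; split.
Qed.

Let p_ge0 v : 0 <= p v. Proof. exact: fine_ge0. Qed.

Let mass_q k : (k <= m)%N -> head_mass p k = q k.
Proof.
move=> km; rewrite /q -(_ : [set x | (cell x <= k)%N] = E k); last first.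
  by rewrite cell_set km.
by have [_ ->] := law_fiber P (fun v : 'I_m.+2 => (v <= k)%N) measurable_cell.
Qed.

Let event n (s z : R) : set (n.-tuple T) :=
  [set x | exists2 k, (k <= m)%N &
    z * (1 - q k) < s * ((\sum_(i < n) (tnth x i \in E k)%:R) / n%:R - q k)].

Let cell_event n (s z : R) (c : {ffun 'I_n -> 'I_m.+2}) :=
  [exists k : 'I_m.+1, z * (1 - q k) <
    s * ((\sum_(i < n) (c i <= k)%N%:R) / n%:R - q k)].

Let eventE n s z : @event n s z =
  [set x | cell_event s z [ffun i => cell (tnth x i)]].
Proof.
apply/seteqP; split => x /=.
  move=> [k km H]; apply/existsP; exists (Ordinal (km : (k < m.+1)%N)) => /=.
  apply: lt_le_trans H _.
  rewrite le_eqVlt; apply/orP; left; apply/eqP; congr (_ * (_ / _ - _)).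
  by apply: eq_bigr => i _; rewrite ffunE cell_le.
move=> /existsP[k H]; have km : (k <= m)%N by rewrite -ltnS.
exists k => //; apply: lt_le_trans H _.
rewrite le_eqVlt; apply/orP; left; apply/eqP; congr (_ * (_ / _ - _)).
by apply: eq_bigr => i _; rewrite ffunE cell_le.
Qed.

Lemma measurable_nested n (s z : R) : measurable
  [set x : n.-tuple T | exists2 k, (k <= m)%N &
    z * (1 - fine (P (E k))) <
    s * ((\sum_(i < n) (tnth x i \in E k)%:R) / n%:R - fine (P (E k)))].
Proof.
rewrite -/(@event n s z) eventE.
by have [] := @prob_pow_cells _ _ _ P n _ cell (cell_event s z) measurable_cell.
Qed.

(** The events are the partial unions of finitely many cells, so the finite
    maximal inequality applies.  The parameter of the exponential moment is
    [z / q m], the optimal one for a Gaussian variable. *)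
Lemma nested_deviation n (s z : R) : `|s| = 1 -> 0 < z -> 0 < q m < 1 ->
  (prob_pow P n [set x | exists2 k, (k <= m)%N &
    (z * (1 - fine (P (E k))) <
    s * ((\sum_(i < n) (tnth x i \in E k)%:R) / n%:R - fine (P (E k))))%R] <=
  (expR (- (n%:R * ((1 - q m) * z ^+ 2 / (2 * q m) * (2 - expR (z / q m))))))%:E)%E.
Proof.
move=> s1 z0 /andP[q0 q1].
rewrite -/(@event n s z) eventE.
have [_ ->] := @prob_pow_cells _ _ _ P n _ cell (cell_event s z) measurable_cell.
rewrite lee_fin -/p.
pose h := z / q m.
have h0 : 0 < h by rewrite divr_gt0.
have q_lt1 k : (k <= m)%N -> q k < 1.
  move=> km; apply: le_lt_trans q1; rewrite /q fine_le ?fin_num_measure//.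
  by rewrite le_measure ?inE//; exact: ndE.
have qm1 : head_mass p m < 1 by rewrite mass_q.
have := finite_maximal n p_ge0 p_sum1 (h * s * (1 - q m))
  (n%:R * h * (1 - q m) * z) qm1.
set S := (X in X <= _ -> _) => HS.
apply: (@le_trans _ _ S).
  rewrite /S [leLHS]big_mkcond [leRHS]big_mkcond /=.
  apply: ler_sum => c _; case: ifPn => [|_]; last first.
    by case: ifP => // _; apply: prodr_ge0 => i _; exact: fine_ge0.
  move=> /existsP[k Hk]; have km : (k <= m)%N by rewrite -ltnS.
  rewrite ifT//; apply/existsP; exists k.
  rewrite /centred_cell -mulr_suml sumrB sumr_const card_ord mass_q//.
  have qk0 : 0 < 1 - q k by rewrite subr_gt0 q_lt1.
  have [n0|n0] := posnP n.
    have nR : n%:R = 0 :> R by rewrite n0.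
    rewrite big1 => [|i _]; last by have : (i < 0)%N by rewrite -n0 ltn_ord.
    by rewrite nR !mul0r -[q k *+ n]mulr_natr nR !mulr0 subr0 mul0r mulr0.
  have n0' : 0 < n%:R :> R by rewrite ltr0n.
  move: Hk; set N := \sum_(i < n) _ => /ltW Hk.
  rewrite -[q k *+ n]mulr_natl.
  have -> : h * s * (1 - q m) * ((N - n%:R * q k) / (1 - q k)) =
     (h * (1 - q m) * n%:R / (1 - q k)) * (s * (N / n%:R - q k)).
    by field; rewrite !gt_eqF.
  have -> : n%:R * h * (1 - q m) * z =
     (h * (1 - q m) * n%:R / (1 - q k)) * (z * (1 - q k)).
    by field; rewrite !gt_eqF.
  have qm0 : 0 < 1 - q m by rewrite subr_gt0.
  have C0 : 0 <= h * (1 - q m) * n%:R / (1 - q k).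
    by apply: divr_ge0; [apply: mulr_ge0; [apply: mulr_ge0|]|]; exact: ltW.
  by rewrite ler_wpM2l//.
apply: le_trans HS _.
have mgf : \sum_v p v * expR (h * s * (1 - q m) * centred_cell p m v) <=
    expR (h ^+ 2 * (q m * (1 - q m)) / 2 * expR h).
  have q01 : 0 <= q m <= 1 by rewrite (ltW q0) (ltW q1).
  have := bernoulli_mgf (h * s) q01.
  rewrite normrM s1 mulr1 gtr0_norm// exprMn -[s ^+ 2]real_normK ?num_real//.
  rewrite s1 expr1n mulr1; apply: le_trans.
  rewrite (bigID (fun v : 'I_m.+2 => (v <= m)%N)) /=.
  rewrite le_eqVlt; apply/orP; left; apply/eqP; congr (_ + _).
    rewrite -{2}mass_q// /head_mass mulr_suml; apply: eq_bigr => v vm.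
    rewrite /centred_cell vm mass_q//; congr (_ * expR _).
    by rewrite /=; field; lra.
  have qmC : 1 - q m = \sum_(v : 'I_m.+2 | ~~ (v <= m)%N) p v.
    rewrite -mass_q// -p_sum1 [X in X - _](bigID (fun v : 'I_m.+2 => (v <= m)%N)) /=.
    by rewrite addrAC subrr add0r.
  rewrite [in RHS]qmC mulr_suml; apply: eq_bigr => v vm.
  rewrite /centred_cell (negbTE vm) mass_q//; congr (_ * expR _).
  by rewrite /=; field; lra.
apply: (@le_trans _ _ (expR (- (n%:R * h * (1 - q m) * z)) *
    (expR (h ^+ 2 * (q m * (1 - q m)) / 2 * expR h)) ^+ n)).
  rewrite ler_wpM2l ?expR_ge0// lerXn2r// ?nnegrE ?expR_ge0//.
  by apply: sumr_ge0 => v _; rewrite mulr_ge0 ?expR_ge0.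
rewrite -expRM_natl -expRD ler_expR -/h le_eqVlt; apply/orP; left; apply/eqP.
have -> : z = h * q m by rewrite /h divfK// gt_eqF.
by field; rewrite gt_eqF.
Qed.

End nested_events.

(** * The empirical process on a grid *)

Definition df (R : realType) (P : probability (measurableTypeR R) R) (t : R) : R :=
  fine (P `]-oo, t]%classic).

(** The exponent of a block on which the distribution function grows from [u]
    to [v], for deviations of size [y]: the Chernoff exponent of
    [nested_deviation] at the end of the block, with threshold [y / (1 - u)]
    taken from its beginning. *)
Definition dev_rate (R : realType) (u v y : R) : R :=
  (1 - v) * y ^+ 2 / (2 * v * (1 - u) ^+ 2) * (2 - expR (y / ((1 - u) * v))).

Section grid.
Context {R : realType} (P : probability (measurableTypeR R) R).
Local Notation T := (measurableTypeR R).
Local Notation F := (df P).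

Lemma df_nd s t : s <= t -> F s <= F t.
Proof.
move=> st; rewrite fine_le ?fin_num_measure// le_measure ?inE//.
exact: subset_itvl.
Qed.

Lemma fine_tail t : fine (P `]t, +oo[%classic) = 1 - F t.
Proof.
rewrite -setCitvl probability_setC// /F -[X in (_ - X)%E]fineK ?fin_num_measure//.
Qed.

Lemma ecdf_mem n (x : n.-tuple T) t :
  ecdf x t = (\sum_(i < n) (tnth x i \in `]-oo, t]%classic)%:R) / n%:R.
Proof.
rewrite /ecdf; congr (_ / _); apply: eq_bigr => i _; congr (_%:R).
by congr nat_of_bool; apply/idP/idP; rewrite inE /= in_itv.
Qed.

Lemma ecdf_tail n (x : n.-tuple T) t : (0 < n)%N ->
  1 - ecdf x t = (\sum_(i < n) (tnth x i \in `]t, +oo[%classic)%:R) / n%:R.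
Proof.
move=> n0; rewrite ecdf_mem.
have n0' : n%:R != 0 :> R by rewrite pnatr_eq0 -lt0n.
rewrite -[X in X - _](divff n0') -mulrBl; congr (_ / _).
rewrite -[in n%:R](card_ord n) -sumr_const -sumrB; apply: eq_bigr => i _.
have -> : (tnth x i \in `]t, +oo[%classic) = ~~ (tnth x i \in `]-oo, t]%classic).
  by apply/idP/negP; rewrite !inE /= !in_itv /= andbT ltNge => /negP.
by case: (_ \in _); rewrite ?subrr ?subr0.
Qed.

Lemma measurable_ecdf n t : measurable_fun [set: n.-tuple T] (fun x : n.-tuple T => ecdf x t).
Proof.
apply: measurable_funM => //.
apply: measurable_sum => i.
pose B := [set x : n.-tuple T | (tnth x i <= t)%R].
have mB : measurable B.
  rewrite -[B]setTI; apply: (@measurable_tnth _ T n i measurableT `]-oo, t]%classic).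
  exact: measurable_itv.
have -> : (fun x : n.-tuple T => ((tnth x i <= t)%R)%:R) = \1_B :> (_ -> R).
  by apply/funext => x; rewrite indicE; congr (_%:R); congr nat_of_bool;
    apply/idP/idP; rewrite inE.
exact: measurable_indic.
Qed.

Lemma measurable_dev n t (s y z : R) :
  measurable [set x : n.-tuple T | y < s * (ecdf x t - z)].
Proof.
rewrite -[X in measurable X]setTI.
have -> : [set x : n.-tuple T | y < s * (ecdf x t - z)] =
  (fun x => s * (ecdf x t - z)) @^-1` `]y, +oo[%classic.
  by apply/seteqP; split => x /=; rewrite in_itv/= andbT.
have mf : measurable_fun [set: n.-tuple T] (fun x : n.-tuple T => s * (ecdf x t - z)).
  apply: measurable_funM => //; apply: measurable_funB => //.
  exact: measurable_ecdf.
exact: mf.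
Qed.

Let measurable_dev_grid n M (g : nat -> R) (s y : R) :
  measurable [set x : n.-tuple T | exists2 k, (k <= M)%N & y < s * (ecdf x (g k) - F (g k))].
Proof.
have -> : [set x : n.-tuple T | exists2 k, (k <= M)%N & y < s * (ecdf x (g k) - F (g k))] =
    \bigcup_(k in [set k | (k <= M)%N]) [set x | y < s * (ecdf x (g k) - F (g k))].
  by apply/seteqP; split => x /= [k kM H]; exists k.
by apply: bigcup_measurable => k _; exact: measurable_dev.
Qed.

Let two_sided n M (g : nat -> R) (y c : R) :
  (forall s : R, (`|s| = 1)%R -> prob_pow P n
    [set x | exists2 k, (k <= M)%N & (y < s * (ecdf x (g k) - F (g k)))%R] <= c%:E)%E ->
  (prob_pow P n [set x | exists2 k, (k <= M)%N & (y < `|ecdf x (g k) - F (g k)|)%R]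
   <= (2 * c)%:E)%E.
Proof.
move=> Hc.
have -> : [set x : n.-tuple T | exists2 k, (k <= M)%N & y < `|ecdf x (g k) - F (g k)|] =
  [set x | exists2 k, (k <= M)%N & y < 1 * (ecdf x (g k) - F (g k))] `|`
  [set x | exists2 k, (k <= M)%N & y < (-1) * (ecdf x (g k) - F (g k))].
  apply/seteqP; split => x /=.
    move=> [k kM]; rewrite ltr_normr => /orP[H|H]; last first.
      by right; exists k => //; rewrite mulN1r.
    by left; exists k => //; rewrite mul1r.
  move=> [] [k kM]; rewrite ?mul1r ?mulN1r => H; exists k => //; 
    by rewrite ltr_normr H ?orbT.
apply: le_trans (measureU2 _ _ _) _; [exact: measurable_dev_grid..|].
rewrite mulr_natl EFinD; apply: leeD; apply: Hc.
  exact: normr1.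
by rewrite normrN1.
Qed.

Variables (n M : nat) (g : nat -> R) (y : R).
Hypotheses (n0 : (0 < n)%N) (y0 : 0 < y)
  (ndg : forall k l, (k <= l)%N -> (l <= M)%N -> g k <= g l).

(** The process [(ecdf - F) / (1 - F)] is a martingale in [t]: its values on
    the whole grid are controlled by the last one, at the price of comparing
    [y] with the factor [1 - F] at the first point. *)
Lemma grid_forward : 0 < F (g M) < 1 ->
  (prob_pow P n [set x | exists2 k, (k <= M)%N & (y < `|ecdf x (g k) - F (g k)|)%R] <=
   (2 * expR (- (n%:R * dev_rate (F (g 0%N)) (F (g M)) y)))%:E)%E.
Proof.
move=> FM; have /andP[FM0 FM1] := FM.
pose E k : set T := `]-oo, g k]%classic.
pose z := y / (1 - F (g 0%N)).
have u1 : 0 < 1 - F (g 0%N) by rewrite subr_gt0 (le_lt_trans _ FM1)// df_nd// ndg.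
have z0 : 0 < z by rewrite divr_gt0.
have mE k : measurable (E k) by exact: measurable_itv.
have ndE k l : (k <= l)%N -> (l <= M)%N -> E k `<=` E l.
  by move=> kl lM; apply: subset_itvl; rewrite bnd_simp ndg.
apply: two_sided => s s1.
have -> : dev_rate (F (g 0%N)) (F (g M)) y =
    (1 - F (g M)) * z ^+ 2 / (2 * F (g M)) * (2 - expR (z / F (g M))).
  rewrite /dev_rate /z; congr (_ * (_ - expR _)); by field; rewrite !gt_eqF.
apply: le_trans (@nested_deviation _ _ _ P M E mE ndE n s z s1 z0 FM).
rewrite le_measure ?inE; [by []|exact: measurable_dev_grid|exact: measurable_nested|].
move=> x [k kM H]; exists k => //; rewrite -ecdf_mem; apply: le_lt_trans H.
by rewrite /z mulrAC ler_pdivrMr// (ler_wpM2l (ltW y0))// lerD2l lerN2 df_nd// ndg.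
Qed.

(** The mirror image: the events [X > t] increase as [t] decreases. *)
Lemma grid_backward : 0 < F (g 0%N) < 1 ->
  (prob_pow P n [set x | exists2 k, (k <= M)%N & (y < `|ecdf x (g k) - F (g k)|)%R] <=
   (2 * expR (- (n%:R * dev_rate (1 - F (g M)) (1 - F (g 0%N)) y)))%:E)%E.
Proof.
move=> F0; have /andP[F00 F01] := F0.
pose E k : set T := `]g (M - k)%N, +oo[%classic.
have PE k : fine (P (E k)) = 1 - F (g (M - k)%N) by exact: fine_tail.
pose z := y / F (g M).
have u1 : 0 < F (g M) by rewrite (lt_le_trans F00)// df_nd// ndg.
have z0 : 0 < z by rewrite divr_gt0.
have mE k : measurable (E k) by exact: measurable_itv.
have ndE k l : (k <= l)%N -> (l <= M)%N -> E k `<=` E l.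
  by move=> kl lM; apply: subset_itvr; rewrite bnd_simp ndg ?leq_sub2l ?leq_subr.
have FM : 0 < fine (P (E M)) < 1 by rewrite PE subnn; lra.
apply: two_sided => s s1.
have -> : dev_rate (1 - F (g M)) (1 - F (g 0%N)) y =
    (1 - fine (P (E M))) * z ^+ 2 / (2 * fine (P (E M))) *
    (2 - expR (z / fine (P (E M)))).
  have v1 : 1 - F (g 0%N) != 0 by rewrite subr_eq0 gt_eqF.
  rewrite PE subnn /dev_rate /z !opprB !(addrC 1 (_ - 1)) !subrK.
  by congr (_ * (_ - expR _)); field; rewrite v1 gt_eqF.
have s1' : `|- s| = 1 by rewrite normrN.
apply: le_trans (@nested_deviation _ _ _ P M E mE ndE n (- s) z s1' z0 FM).
rewrite le_measure ?inE; [by []|exact: measurable_dev_grid|exact: measurable_nested|].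
move=> x [k kM H]; exists (M - k)%N; first exact: leq_subr.
rewrite -ecdf_tail// PE subKn//.
have -> : - s * (1 - ecdf x (g k) - (1 - F (g k))) = s * (ecdf x (g k) - F (g k)).
  by ring.
apply: le_lt_trans H.
rewrite opprB addrC subrK /z mulrAC ler_pdivrMr// (ler_wpM2l (ltW y0))// df_nd// ndg//.
Qed.

End grid.

(** * From grids to intervals *)

Definition dyadic (R : realType) (a b : R) (m k : nat) : R :=
  a + (b - a) * (k%:R / 2 ^+ m).

Section dyadic.
Variable R : realType.
Implicit Types a b t : R.

Lemma dyadic0 a b m : dyadic a b m 0 = a.
Proof. by rewrite /dyadic mul0r mulr0 addr0. Qed.

Lemma dyadic_last a b m : dyadic a b m (2 ^ m) = b.
Proof.
by rewrite /dyadic natrX divff ?expf_neq0// mulr1 addrC subrK.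
Qed.

Lemma dyadic_nd a b m k l : a <= b -> (k <= l)%N -> dyadic a b m k <= dyadic a b m l.
Proof.
move=> ab kl; rewrite lerD2l ler_wpM2l ?subr_ge0//.
by rewrite ler_pM2r ?invr_gt0 ?exprn_gt0// ler_nat.
Qed.

Lemma dyadic_itv a b m k : a <= b -> (k <= 2 ^ m)%N -> a <= dyadic a b m k <= b.
Proof.
move=> ab km; apply/andP; split.
  by rewrite -[leLHS](dyadic0 a b m) dyadic_nd.
by rewrite -[leRHS](dyadic_last a b m) dyadic_nd.
Qed.

Lemma dyadic_refine a b m k : dyadic a b m k = dyadic a b m.+1 k.*2.
Proof.
rewrite /dyadic -muln2 natrM exprS; congr (_ + _ * _).
by field; rewrite expf_neq0.
Qed.

(** Dyadic points approach every [t < b] from the right inside [[a, b]], so a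
    property that persists to the right is detected on the grid. *)
Lemma dyadic_hit a b (Q : R -> Prop) : a <= b ->
  (forall t, a <= t < b -> Q t -> \forall s \near t^'+, Q s) ->
  (exists2 t, a <= t <= b & Q t) ->
  exists m, exists2 k, (k <= 2 ^ m)%N & Q (dyadic a b m k).
Proof.
move=> ab Qr [t /andP[at_ tb] Qt].
have [tb'|tb'] := eqVneq t b.
  by exists 0%N, 1%N => //; rewrite (_ : 1%N = (2 ^ 0)%N)// dyadic_last -tb'.
have {}tb : t < b by rewrite lt_neqAle tb'.
have ab' : 0 < b - a by rewrite subr_gt0 (le_lt_trans at_).
have [e /= e0 He] : \forall s \near t^'+, Q s by apply: Qr; rewrite ?at_.
pose e' := Num.min e (b - t).
have e'0 : 0 < e' by rewrite lt_min e0 subr_gt0.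
pose m := Num.bound ((b - a) / e').
have m2 : (b - a) / 2 ^+ m < e'.
  rewrite ltr_pdivrMr ?exprn_gt0// mulrC -ltr_pdivrMr//.
  exact: upper_nthrootP.
pose u := (t - a) / (b - a) * 2 ^+ m.
have u0 : 0 <= u by rewrite mulr_ge0 ?exprn_ge0// divr_ge0 ?subr_ge0// ltW.
have tE : t = a + (b - a) * (u / 2 ^+ m).
  by rewrite /u; field; rewrite expf_neq0//= gt_eqF.
pose k := (Num.truncn u).+1.
have /andP[ku uk] := truncn_itv u0.
have sgt : t < dyadic a b m k.
  rewrite {1}tE ltrD2l ltr_pM2l// ltr_pM2r ?invr_gt0 ?exprn_gt0//.
have slt : dyadic a b m k < t + e'.
  apply: le_lt_trans (_ : t + (b - a) / 2 ^+ m < _); last by rewrite ltrD2l.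
  rewrite {1}tE -addrA lerD2l -mulrDr ler_pM2l// -[X in _ + X]mul1r -mulrDl.
  by rewrite ler_pM2r ?invr_gt0 ?exprn_gt0// /k -natr1 lerD2r.
exists m, k.
  rewrite leqNgt; apply/negP => km.
  have : b <= dyadic a b m k by rewrite -{1}(dyadic_last a b m) dyadic_nd// ltnW.
  apply/negP; rewrite -ltNge; apply: lt_le_trans slt _.
  by rewrite -lerBrDl /e' ge_min lexx orbT.
apply: He => //=.
rewrite ltr_norml; have : e' <= e by rewrite /e' ge_min lexx.
by lra.
Qed.

Lemma dev_eventE n (a b : R) (F g : R -> R) : a <= b ->
  (forall t, a <= t < b -> F s @[s --> t^'+] --> F t) ->
  (forall t, a <= t < b -> g s @[s --> t^'+] --> g t) ->
  [set x : n.-tuple (measurableTypeR R) |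
     exists2 t, a <= t <= b & g t < `|ecdf x t - F t|] =
  \bigcup_m [set x | exists2 k, (k <= 2 ^ m)%N &
     g (dyadic a b m k) < `|ecdf x (dyadic a b m k) - F (dyadic a b m k)|].
Proof.
move=> ab Fr gr; apply/seteqP; split => x /=; last first.
  by move=> [m _ [k km H]]; exists (dyadic a b m k) => //; exact: dyadic_itv.
move=> H; suff [m Hm] : exists m, exists2 k, (k <= 2 ^ m)%N &
     g (dyadic a b m k) < `|ecdf x (dyadic a b m k) - F (dyadic a b m k)|.
  by exists m.
apply: (@dyadic_hit a b (fun t => g t < `|ecdf x t - F t|) ab _ H).
move=> t atb Qt.
have ecdf_r : ecdf x s @[s --> t^'+] --> ecdf x t.
  apply: cvg_near_cst.
  have H1 (i : 'I_n) : \forall s \near t^'+, (tnth x i <= s) = (tnth x i <= t).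
    have [it|ti] := leP (tnth x i) t.
      near=> s; apply/(le_trans it)/ltW.
      by near: s; exact: nbhs_right_gt.
    near=> s; apply/negbTE; rewrite -ltNge.
    by near: s; exact: nbhs_right_lt.
  have H2 : \forall s \near t^'+, forall i : 'I_n, (tnth x i <= s) = (tnth x i <= t).
    exact: filter_forall.
  apply: filterS H2 => s Hs; rewrite /ecdf; congr (_ / _).
  by apply: eq_bigr => i _; rewrite Hs.
have lim : (`|ecdf x s - F s| - g s) @[s --> t^'+] --> `|ecdf x t - F t| - g t.
  exact: cvgB (cvg_norm (cvgB ecdf_r (Fr _ atb))) (gr _ atb).
have pos : 0 < `|ecdf x t - F t| - g t by rewrite subr_gt0.
have H3 : \forall s \near t^'+, 0 < `|ecdf x s - F s| - g s by exact: cvgr_gt lim _ pos.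
by apply: filterS H3 => s; rewrite subr_gt0.
Unshelve. all: by end_near. Qed.

Lemma measurable_dev_level n M (t g z : nat -> R) :
  measurable [set x : n.-tuple (measurableTypeR R) |
    exists2 k, (k <= M)%N & g k < `|ecdf x (t k) - z k|].
Proof.
rewrite (_ : [set x | _] = \bigcup_(k in [set k | (k <= M)%N])
  ([set x : n.-tuple (measurableTypeR R) | g k < 1 * (ecdf x (t k) - z k)] `|`
   [set x | g k < (-1) * (ecdf x (t k) - z k)])).
  by apply: bigcup_measurable => k _; apply: measurableU; exact: measurable_dev.
apply/seteqP; split => x /= [k km].
  rewrite ltr_normr => /orP H; exists k => //=.
  by rewrite mul1r mulN1r.
by rewrite /= mul1r mulN1r => H; exists k => //; rewrite ltr_normr; apply/orP.
Qed.

Lemma measurable_dev_event n (a b : R) (F g : R -> R) : a <= b ->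
  (forall t, a <= t < b -> F s @[s --> t^'+] --> F t) ->
  (forall t, a <= t < b -> g s @[s --> t^'+] --> g t) ->
  measurable [set x : n.-tuple (measurableTypeR R) |
     exists2 t, a <= t <= b & g t < `|ecdf x t - F t|].
Proof.
move=> ab Fr gr; rewrite dev_eventE//.
apply: bigcupT_measurable => m.
have := @measurable_dev_level n (2 ^ m) (dyadic a b m) (g \o dyadic a b m)
  (F \o dyadic a b m); apply.
Qed.

(** Continuity from below turns bounds uniform in the grid into bounds on the
    whole interval. *)
Lemma bigcup_le d (T : measurableType d) (mu : {measure set T -> \bar R})
    (E : (set T)^nat) (c : \bar R) :
  (forall m, measurable (E m)) -> nondecreasing_seq E ->
  (forall m, (mu (E m) <= c)%E) -> (mu (\bigcup_m E m) <= c)%E.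
Proof.
move=> mE ndE Ec.
have := nondecreasing_cvg_mu (mu := mu) mE (bigcupT_measurable _ mE) ndE.
move=> /cvg_lim <-//.
apply: lime_le; last by apply: nearW => m; exact: Ec.
apply/cvg_ex; exists (mu (\bigcup_m E m)).
exact: nondecreasing_cvg_mu mE (bigcupT_measurable _ mE) ndE.
Qed.

Variable P : probability (measurableTypeR R) R.
Local Notation F := (df P).

Let idTR : measurableTypeR R -> R := idfun.

#[local] HB.instance Definition _ :=
  @isMeasurableFun.Build _ _ _ _ idTR (@measurable_id _ _ setT).

Lemma df_right (t : R) : F s @[s --> t^'+] --> F t.
Proof.
have := @cdf_right_continuous _ _ _ P (idTR : {RV P >-> R}) t.
have -> : cdf (idTR : {RV P >-> R}) t = (F t)%:E by rewrite fineK// fin_num_measure.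
by move=> /fine_cvg.
Qed.

Let exhaust n a b (y c : R) : a <= b ->
  (forall m, (prob_pow P n [set x | exists2 k, (k <= 2 ^ m)%N &
     (y < `|ecdf x (dyadic a b m k) - F (dyadic a b m k)|)%R] <= c%:E)%E) ->
  (prob_pow P n [set x | exists2 t, (a <= t <= b)%R & (y < `|ecdf x t - F t|)%R] <= c%:E)%E.
Proof.
move=> ab Hc; rewrite (@dev_eventE _ _ _ _ (fun=> y))//; last 2 first.
- by move=> t _; exact: df_right.
- by move=> t _; exact: cvg_cst.
apply: bigcup_le => //.
- move=> m; have := @measurable_dev_level n (2 ^ m) (dyadic a b m) (fun=> y)
    (F \o dyadic a b m); exact.
- apply/nondecreasing_seqP => m; apply/subsetPset => x [k km H].
  exists k.*2; last by rewrite -dyadic_refine.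
  by rewrite expnS mul2n leq_double.
Qed.

Lemma block_forward n a b (y : R) : 0 < y -> a <= b -> 0 < F b < 1 ->
  (prob_pow P n [set x | exists2 t, (a <= t <= b)%R & (y < `|ecdf x t - F t|)%R] <=
   (2 * expR (- (n%:R * dev_rate (F a) (F b) y)))%:E)%E.
Proof.
move=> y0 ab Fb; apply: exhaust => // m.
have := @grid_forward _ P n (2 ^ m) (dyadic a b m) y y0.
rewrite dyadic0 dyadic_last; apply => //.
by move=> k l kl _; exact: dyadic_nd.
Qed.

Lemma block_backward n a b (y : R) : (0 < n)%N -> 0 < y -> a <= b -> 0 < F a < 1 ->
  (prob_pow P n [set x | exists2 t, (a <= t <= b)%R & (y < `|ecdf x t - F t|)%R] <=
   (2 * expR (- (n%:R * dev_rate (1 - F b) (1 - F a) y)))%:E)%E.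
Proof.
move=> n0 y0 ab Fa; apply: exhaust => // m.
have := @grid_backward _ P n (2 ^ m) (dyadic a b m) y n0 y0.
rewrite dyadic0 dyadic_last; apply => //.
by move=> k l kl _; exact: dyadic_nd.
Qed.

End dyadic.

(** * Unions of blocks and their exponents *)

Lemma measure_bigcup_ord_le d (T : measurableType d) (R : realType)
    (mu : {measure set T -> \bar R}) (J : nat) (E : nat -> set T) (c : R) :
  (forall j, measurable (E j)) -> (forall j, (j < J)%N -> (mu (E j) <= c%:E)%E) ->
  (mu (\bigcup_(j in [set j | (j < J)%N]) E j) <= (J%:R * c)%:E)%E.
Proof.
move=> mE; elim: J => [|J IH] Ec.
  rewrite (_ : \bigcup_(_ in _) _ = set0) ?measure0 ?mul0r//.
  by apply/seteqP; split => // x [].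
rewrite (_ : \bigcup_(_ in _) _ =
    (\bigcup_(j in [set j | (j < J)%N]) E j) `|` E J); last first.
  apply/seteqP; split => x.
    move=> [j /=]; rewrite ltnS leq_eqVlt => /orP[/eqP -> ?|jJ Ej]; first by right.
    by left; exists j.
  by move=> [[j /= jJ Ej]|Ex]; [exists j => //=; exact: ltnW|exists J => /=].
apply: le_trans (measureU2 _ _ (mE J)) _.
  by apply: bigcup_measurable => j _.
rewrite -natr1 mulrDl mul1r EFinD; apply: leeD; last exact: Ec.
by apply: IH => j jJ; apply: Ec; exact: ltnW.
Qed.

Lemma cover_index (R : realType) (a : nat -> R) (J : nat) (t : R) : (0 < J)%N ->
  a 0%N <= t <= a J -> exists2 j, (j < J)%N & a j <= t <= a j.+1.
Proof.
elim: J => // -[|J] IH _ /andP[t0 tJ]; first by exists 0%N; rewrite ?t0.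
have [tJ'|tJ'] := leP t (a J.+1).
  by have [|j jJ Hj] := IH isT; [rewrite t0|exists j => //; exact: ltnW].
by exists J.+1; rewrite ?ltnSn// tJ ltW.
Qed.

Section cover.
Variables (R : realType) (P : probability (measurableTypeR R) R).
Local Notation F := (df P).
Variables (n J : nat) (a y : nat -> R) (G : R -> R) (r : R).
Hypotheses (n0 : (0 < n)%N) (J0 : (0 < J)%N).
Hypothesis nda : forall j, a j <= a j.+1.
Hypothesis aJ : a J = 2^-1.
Hypothesis y0 : forall j, (j < J)%N -> 0 < y j.
Hypothesis yG : forall j t, (j < J)%N -> a j <= t <= a j.+1 ->
  y j <= G t /\ y j <= G (1 - t).
Hypothesis F01 : forall j, (j < J)%N -> 0 < F (a j.+1) < 1 /\ 0 < F (1 - a j.+1) < 1.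
Hypothesis rate : forall j, (j < J)%N ->
  r <= dev_rate (F (a j)) (F (a j.+1)) (y j) /\
  r <= dev_rate (1 - F (1 - a j)) (1 - F (1 - a j.+1)) (y j).
Hypothesis mE : measurable [set x : n.-tuple (measurableTypeR R) |
  exists2 t, a 0%N <= t <= 1 - a 0%N & G t < `|ecdf x t - F t|].

(** Blocks [[a j, a j.+1]] exhaust the left half and are controlled by the
    forward martingale; their mirror images use the backward one.  In this way
    the distribution function never gets close to 1 (resp. 0) at the end of a
    block, where the martingale would be too large. *)
Lemma cover_deviation :
  (prob_pow P n [set x | exists2 t, (a 0%N <= t <= 1 - a 0%N)%R &
     (G t < `|ecdf x t - F t|)%R] <= (4 * J%:R * expR (- (n%:R * r)))%:E)%E.
Proof.
pose B (lo hi z : R) := [set x : n.-tuple (measurableTypeR R) |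
  exists2 t, lo <= t <= hi & z < `|ecdf x t - F t|].
have mB lo hi z : lo <= hi -> measurable (B lo hi z).
  move=> lohi; apply: (@measurable_dev_event _ _ _ _ F (fun=> z)) => // t _.
    exact: df_right.
  exact: cvg_cst.
have nda1 j : 1 - a j.+1 <= 1 - a j by rewrite lerD2l lerN2.
pose E j := B (a j) (a j.+1) (y j) `|` B (1 - a j.+1) (1 - a j) (y j).
have mEj j : measurable (E j) by apply: measurableU; exact: mB.
have sub : [set x : n.-tuple (measurableTypeR R) |
    exists2 t, a 0%N <= t <= 1 - a 0%N & G t < `|ecdf x t - F t|] `<=`
    \bigcup_(j in [set j | (j < J)%N]) E j.
  move=> x [t /andP[t0 t1] Gt]; have [t2|t2] := leP t 2^-1.
    have [|j jJ jt] := @cover_index _ a J t J0; first by rewrite t0 aJ.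
    exists j => //; left; exists t => //; apply: le_lt_trans Gt.
    by have [] := yG jJ jt.
  have [|j jJ jt] := @cover_index _ a J (1 - t) J0; first by rewrite aJ; lra.
  exists j => //; right; exists t; first by lra.
  apply: le_lt_trans Gt; have [_] := yG jJ jt.
  by rewrite opprB addrC subrK.
apply: le_trans (le_measure (prob_pow P n) _ _ sub) _; rewrite ?inE//.
  by apply: bigcup_measurable => j _; exact: mEj.
rewrite (_ : 4 * _ * _ = J%:R * (2 * expR (- (n%:R * r)) + 2 * expR (- (n%:R * r))));
  last by ring.
apply: measure_bigcup_ord_le => // j jJ.
have [F1 F2] := F01 jJ; have [r1 r2] := rate jJ.
apply: le_trans (measureU2 _ (mB _ _ _ (nda j)) (mB _ _ _ (nda1 j))) _.
have expr_le r' : r <= r' -> 2 * expR (- (n%:R * r')) <= 2 * expR (- (n%:R * r)).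
  by move=> rr'; rewrite ler_pM2l// ler_expR lerN2 ler_wpM2l.
rewrite EFinD; apply: leeD.
  by apply: le_trans (block_forward _ (y0 jJ) (nda j) F1) _; rewrite lee_fin expr_le.
by apply: le_trans (block_backward n0 (y0 jJ) (nda1 j) F2) _; rewrite lee_fin expr_le.
Qed.

End cover.

Section rates.
Variable R : realType.
Implicit Types (a b u v w x : R).

Lemma expR_le1D2 x : 0 <= x <= 2^-1 -> expR x <= 1 + 2 * x.
Proof.
move=> x01; have e0 := expR_gt0 x.
have := expRxMexpNx_1 x; have := expR_ge1Dx (- x) => e1 e2.
have : expR x * (1 - x) <= 1 by rewrite -[leRHS]e2 ler_wpM2l// ltW.
nra.
Qed.

(** [x] bounds the parameter of the exponential moment and [c] the Gaussian
    part of the exponent. *)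
Lemma dev_rate_ge u v w c x : 0 < v -> u < 1 -> 0 <= x <= 2^-1 -> 0 < w -> 0 <= c ->
  w <= x * ((1 - u) * v) -> c * (2 * v * (1 - u) ^+ 2) <= (1 - v) * w ^+ 2 ->
  c * (1 - 2 * x) <= dev_rate u v w.
Proof.
move=> v0 u1 x01 w0 c0 wx cv.
have u1' : 0 < 1 - u by lra.
rewrite /dev_rate; apply: ler_pM => //.
- by lra.
- by rewrite ler_pdivlMr// !mulr_gt0// exprn_gt0.
- have : expR (w / ((1 - u) * v)) <= expR x.
    by rewrite ler_expR ler_pdivrMr// mulr_gt0.
  have := expR_le1D2 x01; lra.
Qed.

(** For a threshold proportional to the standard deviation the Gaussian part
    is [w ^+ 2 / 2] times the ratio of the variances at both ends of the block,
    which is close to 1 because the block is short on the logarithmic scale.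
    Of the loss [14 * eta], [6 * eta] comes from this ratio and from the
    distance between [u], [v] and [a], [b], and [8 * eta] from the remainder of
    the exponential moment. *)
Lemma dev_rate_weighted (eta a b u v w : R) : 0 < eta <= 8^-1 -> 0 < a ->
  a <= b -> b <= (1 + eta) * a -> b <= 2^-1 ->
  `|u - a| <= eta * a -> `|v - b| <= eta * b -> 0 < w -> w ^+ 2 <= eta ^+ 2 * a ->
  w ^+ 2 / 2 * (1 - 14 * eta) <= dev_rate u v (w * Num.sqrt (a * (1 - a))).
Proof.
move=> /andP[e0 e1] a0 ab bea b2; rewrite !ler_distl => /andP[u1 u2] /andP[v1 v2] w0 wa.
have a1 : 0 < 1 - a by lra.
have aa0 : 0 <= a * (1 - a) by apply: mulr_ge0; exact: ltW.
have sE : (w * Num.sqrt (a * (1 - a))) ^+ 2 = w ^+ 2 * (a * (1 - a)).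
  by rewrite exprMn sqr_sqrtr.
have y0 : 0 < w * Num.sqrt (a * (1 - a)) by apply: mulr_gt0; rewrite // sqrtr_gt0 mulr_gt0.
have v0 : 0 < v by nra.
have u11 : u < 1 by nra.
have c0 : 0 <= w ^+ 2 / 2 * (1 - 6 * eta).
  by rewrite mulr_ge0 ?divr_ge0 ?sqr_ge0//; lra.
apply: le_trans (@dev_rate_ge _ _ _ (w ^+ 2 / 2 * (1 - 6 * eta)) (4 * eta) v0 u11 _ y0 c0 _ _).
- rewrite -[leRHS]mulrA ler_wpM2l ?divr_ge0 ?sqr_ge0//; nra.
- by lra.
- have rhs0 : 0 <= 4 * eta * ((1 - u) * v) by rewrite !mulr_ge0//; lra.
  rewrite -(@ler_pXn2r _ 2)// ?nnegrE ?(ltW y0)// sE.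
  have h1 : (1 - eta) * (1 - a) <= 1 - u by nra.
  have h2 : (1 - eta) * a <= v by nra.
  have h3 : (1 - eta) * (1 - a) * ((1 - eta) * a) <= (1 - u) * v.
    by apply: ler_pM => //; rewrite mulr_ge0//; lra.
  have h4 : (49 / 64) * (a * (1 - a)) <= (1 - u) * v.
    apply: le_trans h3; rewrite (_ : (1 - eta) * (1 - a) * ((1 - eta) * a) =
      (1 - eta) ^+ 2 * (a * (1 - a))); last by ring.
    rewrite ler_wpM2r//; nra.
  have h5 : ((49 / 64) * (a * (1 - a))) ^+ 2 <= ((1 - u) * v) ^+ 2.
    have l0 : 0 <= 49 / 64 * (a * (1 - a)) by apply: mulr_ge0.
    by rewrite lerXn2r// nnegrE// (le_trans l0).
  rewrite exprMn; apply: (@le_trans _ _ (eta ^+ 2 * a * (a * (1 - a)))).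
    by rewrite ler_wpM2r.
  apply: (@le_trans _ _ ((4 * eta) ^+ 2 * (49 / 64 * (a * (1 - a))) ^+ 2)); last first.
    by rewrite ler_wpM2l ?sqr_ge0.
  have -> : eta ^+ 2 * a * (a * (1 - a)) = (eta * a) ^+ 2 * (1 - a) by ring.
  have -> : (4 * eta) ^+ 2 * (49 / 64 * (a * (1 - a))) ^+ 2 =
    (eta * a) ^+ 2 * ((49 / 16) ^+ 2 * (1 - a) ^+ 2) by field.
  by rewrite ler_wpM2l ?sqr_ge0//; nra.
- rewrite sE.
  have h1 : v <= (1 + eta) ^+ 2 * a by nra.
  have h2 : 1 - u <= (1 + eta) * (1 - a) by nra.
  have h3 : (1 - eta) ^+ 2 * (1 - a) <= 1 - v by nra.
  have h4 : v * (1 - u) ^+ 2 <= ((1 + eta) ^+ 2 * a) * ((1 + eta) * (1 - a)) ^+ 2.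
    apply: ler_pM => //; rewrite ?sqr_ge0 ?(ltW v0)// lerXn2r// ?nnegrE; lra.
  have h5 : (1 - 6 * eta) * (1 + eta) ^+ 4 <= (1 - eta) ^+ 2 by nra.
  have h6 : (1 - 6 * eta) * (v * (1 - u) ^+ 2) <= (1 - eta) ^+ 2 * (1 - a) * (a * (1 - a)).
    apply: (@le_trans _ _ ((1 - 6 * eta) * (((1 + eta) ^+ 2 * a) * ((1 + eta) * (1 - a)) ^+ 2))).
      by rewrite ler_wpM2l//; lra.
    have -> : (1 - 6 * eta) * (((1 + eta) ^+ 2 * a) * ((1 + eta) * (1 - a)) ^+ 2) =
      (1 - 6 * eta) * (1 + eta) ^+ 4 * (a * (1 - a) ^+ 2) by ring.
    have -> : (1 - eta) ^+ 2 * (1 - a) * (a * (1 - a)) =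
      (1 - eta) ^+ 2 * (a * (1 - a) ^+ 2) by ring.
    by rewrite ler_wpM2r// mulr_ge0 ?sqr_ge0//; exact: ltW.
  have -> : w ^+ 2 / 2 * (1 - 6 * eta) * (2 * v * (1 - u) ^+ 2) =
    w ^+ 2 * ((1 - 6 * eta) * (v * (1 - u) ^+ 2)) by field.
  rewrite [leRHS]mulrCA ler_wpM2l ?sqr_ge0//; apply: le_trans h6 _.
  by rewrite ler_wpM2r.
Qed.

(** For a constant threshold the exponent is smallest where the variance
    [v * (1 - v)] is largest, whence the factor 2.  The loss is [10 * del] for
    the length of the block and the distance between [u], [v] and [a], [b], and
    again [10 * del] for the remainder. *)
Lemma dev_rate_uniform (del a b u v w : R) : 0 < del <= 10^-1 -> 0 <= a ->
  a <= b <= a + del -> del <= b <= 2^-1 ->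
  `|u - a| <= del / 2 -> `|v - b| <= del / 2 -> 0 < w <= del ^+ 2 ->
  2 * w ^+ 2 * (1 - 20 * del) <= dev_rate u v w.
Proof.
move=> /andP[d0 d1] a0 /andP[ab ba] /andP[db b2].
rewrite !ler_distl => /andP[u1 u2] /andP[v1 v2] /andP[w0 wd].
have v0 : 0 < v by lra.
have u11 : u < 1 by lra.
have c0 : 0 <= 2 * w ^+ 2 * (1 - 10 * del).
  by rewrite mulr_ge0 ?mulr_ge0 ?sqr_ge0//; lra.
apply: le_trans (@dev_rate_ge _ _ _ (2 * w ^+ 2 * (1 - 10 * del)) (5 * del) v0 u11 _ w0 c0 _ _).
- rewrite -[leRHS]mulrA ler_wpM2l ?mulr_ge0 ?sqr_ge0//; nra.
- by lra.
- apply: le_trans wd _.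
  have : (9 / 20) * (del / 2) <= (1 - u) * v by apply: ler_pM; lra.
  nra.
- have h1 : 1 - u <= (1 - v) * (1 + 5 * del) by nra.
  have h2 : (1 - u) ^+ 2 <= (1 - v) ^+ 2 * (1 + 5 * del) ^+ 2.
    by rewrite -exprMn lerXn2r// ?nnegrE; lra.
  have h3 : (1 - 10 * del) * (1 + 5 * del) ^+ 2 <= 1 by nra.
  have h4 : (1 - 10 * del) * (1 - u) ^+ 2 <= (1 - v) ^+ 2.
    apply: (@le_trans _ _ ((1 - 10 * del) * ((1 - v) ^+ 2 * (1 + 5 * del) ^+ 2))).
      by rewrite ler_wpM2l//; lra.
    by rewrite mulrCA -[leRHS]mulr1 ler_wpM2l ?sqr_ge0.
  have h5 : 4 * v * (1 - v) <= 1 by have := sqr_ge0 (1 - 2 * v); nra.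
  have -> : 2 * w ^+ 2 * (1 - 10 * del) * (2 * v * (1 - u) ^+ 2) =
    w ^+ 2 * (4 * v * ((1 - 10 * del) * (1 - u) ^+ 2)) by ring.
  rewrite [leRHS]mulrC ler_wpM2l ?sqr_ge0//.
  apply: (@le_trans _ _ (4 * v * (1 - v) ^+ 2)).
    by rewrite ler_wpM2l// mulr_ge0//; exact: ltW.
  by rewrite expr2 mulrA -[leRHS]mul1r ler_wpM2r//; lra.
Qed.

End rates.

(** * Tails of the two suprema *)

Section tails.
Variables (R : realType) (P : probability (measurableTypeR R) R) (n : nat).
Local Notation F := (df P).
Hypothesis n0 : (0 < n)%N.

Lemma cvg_bridge_sd (t : R) :
  Num.sqrt (s * (1 - s)) @[s --> t^'+] --> Num.sqrt (t * (1 - t)).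
Proof.
apply: cvg_at_right_filter.
apply: (@continuous_comp _ _ _ (fun s : R => s * (1 - s)) Num.sqrt).
  apply: cvgM; first exact: cvg_id.
  by apply: cvgB; [exact: cvg_cst|exact: cvg_id].
exact: sqrt_continuous.
Qed.

Lemma weighted_tail (J : nat) (kappa eta w : R) :
  0 < kappa < 2^-1 -> 0 < eta <= 8^-1 -> 0 < w -> w ^+ 2 <= eta ^+ 2 * kappa ->
  (forall t, kappa <= t <= 1 - kappa ->
    `|F t - t| <= eta * t /\ `|F t - t| <= eta * (1 - t)) ->
  2^-1 <= kappa * (1 + eta) ^+ J ->
  (prob_pow P n [set x | exists2 t, (kappa <= t <= 1 - kappa)%R &
     (w * Num.sqrt (t * (1 - t)) < `|ecdf x t - F t|)%R] <=
   (4 * J%:R * expR (- (n%:R * (w ^+ 2 / 2 * (1 - 14 * eta)))))%:E)%E.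
Proof.
move=> /andP[k0 k1] /andP[e0 e1] w0 wk HF HJ.
have e1' : 0 < 1 + eta by lra.
(* the progression is stopped at 1/2, later blocks are single points *)
pose a j := Num.min (kappa * (1 + eta) ^+ j) 2^-1.
have a00 : a 0%N = kappa by rewrite /a expr0 mulr1 min_l// ltW.
have aJ : a J = 2^-1 by rewrite /a min_r.
have J0 : (0 < J)%N.
  rewrite lt0n; apply/eqP => J0; move: HJ k1.
  by rewrite J0 expr0 mulr1 leNgt => /negP.
have pw j : 0 < kappa * (1 + eta) ^+ j by rewrite mulr_gt0// exprn_gt0.
have pwS j : kappa * (1 + eta) ^+ j.+1 = (1 + eta) * (kappa * (1 + eta) ^+ j).
  by rewrite exprS mulrCA.
have nda j : a j <= a j.+1.
  rewrite /a le_min !ge_min lexx orbT andbT pwS.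
  by rewrite ler_peMl ?(ltW (pw j))//; lra.
have aS j : a j.+1 <= (1 + eta) * a j.
  rewrite /a minr_pMr ?(ltW e1')// le_min -pwS !ge_min lexx /=.
  by apply/orP; right; lra.
have ak j : kappa <= a j.
  by elim: j => [|j IH]; [rewrite a00|rewrite (le_trans IH)].
have a2 j : a j <= 2^-1 by rewrite /a ge_min lexx orbT.
have a0 j : 0 < a j by rewrite (lt_le_trans k0).
have Fa j : `|F (a j) - a j| <= eta * a j.
  by have := ak j; have := a2 j => a2j akj; have [|] := HF (a j); lra.
have Fa' j : `|1 - F (1 - a j) - a j| <= eta * a j.
  have := ak j; have := a2 j => a2j akj; have [|_] := HF (1 - a j); first by lra.
  have -> : 1 - F (1 - a j) - a j = (1 - a j) - F (1 - a j) by ring.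
  by rewrite distrC [X in _ <= _ * X -> _](_ : _ = a j)//; ring.
have -> : [set x : n.-tuple (measurableTypeR R) | exists2 t, kappa <= t <= 1 - kappa &
    w * Num.sqrt (t * (1 - t)) < `|ecdf x t - F t|] =
  [set x | exists2 t, a 0%N <= t <= 1 - a 0%N &
    w * Num.sqrt (t * (1 - t)) < `|ecdf x t - F t|] by rewrite a00.
apply: (@cover_deviation _ P n J a (fun j => w * Num.sqrt (a j * (1 - a j)))
  (fun t => w * Num.sqrt (t * (1 - t)))) => //.
- move=> j jJ; apply: mulr_gt0 => //; rewrite sqrtr_gt0 mulr_gt0//.
  by have := a2 j; lra.
- move=> j t jJ /andP[ajt taj].
  have H : Num.sqrt (a j * (1 - a j)) <= Num.sqrt (t * (1 - t)).
    by have := a2 j.+1; have := a0 j => ? ?; apply: ler_wsqrtr; nra.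
  rewrite !(ler_pM2l w0); split => //; apply: le_trans H _.
  by apply: ler_wsqrtr; rewrite opprB addrCA subrr addr0 mulrC.
- move=> j jJ; have := Fa j.+1; have := Fa' j.+1; have := a2 j.+1; have := a0 j.+1.
  rewrite !ler_distl => ? ? /andP[? ?] /andP[? ?].
  by split; apply/andP; split; nra.
- move=> j jJ; have e01 : 0 < eta <= 8^-1 by rewrite e0.
  have wa : w ^+ 2 <= eta ^+ 2 * a j.
    by apply: le_trans wk _; rewrite ler_wpM2l ?sqr_ge0.
  by split; apply: (dev_rate_weighted e01 (a0 j) (nda j) (aS j)).
- rewrite a00; apply: (@measurable_dev_event _ _ _ _ F (fun t => w * Num.sqrt (t * (1 - t)))).
  + by lra.
  + by move=> t _; exact: df_right.
  + by move=> t _; apply: cvgM; [exact: cvg_cst|exact: cvg_bridge_sd].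
Qed.

Lemma uniform_tail (K : nat) (w : R) : let del := ((2 * K)%:R)^-1 in
  (5 <= K)%N -> 0 < w <= del ^+ 2 ->
  (forall t, 0 <= t <= 1 -> `|F t - t| <= del / 2) ->
  (prob_pow P n [set x | exists2 t, (0 <= t <= 1)%R & (w < `|ecdf x t - F t|)%R] <=
   (4 * K%:R * expR (- (n%:R * (2 * w ^+ 2 * (1 - 20 * del)))))%:E)%E.
Proof.
move=> del K5 wd HF.
have K0 : (0 < K)%N by exact: leq_trans K5.
have K0' : 0 < K%:R :> R by rewrite ltr0n.
have d0 : 0 < del by rewrite invr_gt0 ltr0n muln_gt0.
have d1 : del <= 10^-1 by rewrite lef_pV2 ?posrE ?ltr0n ?muln_gt0// ler_nat (leq_mul2l 2 5).
have d01 : 0 < del <= 10^-1 by rewrite d0.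
pose a (j : nat) : R := j%:R * del.
have a00 : a 0%N = 0 by rewrite /a mul0r.
have aS j : a j.+1 = a j + del by rewrite /a -natr1 mulrDl mul1r.
have nda j : a j <= a j.+1 by rewrite aS lerDl ltW.
have aJ : a K = 2^-1.
  by rewrite /a /del natrM invfM mulrCA divff ?mulr1// gt_eqF.
have a0 j : 0 <= a j by rewrite mulr_ge0// ltW.
have a2 j : (j <= K)%N -> a j <= 2^-1.
  by move=> jK; rewrite -aJ /a ler_wpM2r ?ler_nat// ltW.
have Fa j : (j <= K)%N -> `|F (a j) - a j| <= del / 2.
  by move=> jK; apply: HF; have := a2 _ jK; have := a0 j; lra.
have Fa' j : (j <= K)%N -> `|1 - F (1 - a j) - a j| <= del / 2.
  move=> jK; have -> : 1 - F (1 - a j) - a j = (1 - a j) - F (1 - a j) by ring.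
  by rewrite distrC; apply: HF; have := a2 _ jK; have := a0 j; lra.
have -> : [set x : n.-tuple (measurableTypeR R) | exists2 t, 0 <= t <= 1 &
    w < `|ecdf x t - F t|] = [set x | exists2 t, a 0%N <= t <= 1 - a 0%N &
    w < `|ecdf x t - F t|] by rewrite a00 subr0.
apply: (@cover_deviation _ P n K a (fun=> w) (fun=> w)) => //.
- by move=> j _; have /andP[] := wd.
- move=> j jK; have := Fa _ jK; have := Fa' _ jK; have := a2 _ jK; have := a0 j.
  rewrite aS !ler_distl => ? ? /andP[? ?] /andP[? ?].
  by split; apply/andP; split; lra.
- move=> j jK; have jK' := ltnW jK.
  have h1 : a j <= a j.+1 <= a j + del by rewrite nda aS lexx.
  have h2 : del <= a j.+1 <= 2^-1 by rewrite a2// aS lerDr a0.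
  split; apply: (dev_rate_uniform d01 (a0 j) h1 h2) => //.
  + exact: Fa. + exact: Fa. + exact: Fa'. + exact: Fa'.
- rewrite a00; apply: (@measurable_dev_event _ _ _ _ F (fun=> w)).
  + by lra.
  + by move=> t _; exact: df_right.
  + by move=> t _; exact: cvg_cst.
Qed.

End tails.

(** * A sharp lower bound for the fair coin *)

Lemma finite_chernoff (R : realType) (n : nat) (I : finType) (p g : I -> R) (h y : R) :
  (forall v, 0 <= p v) ->
  \sum_(c : {ffun 'I_n -> I} | y <= h * \sum_(i < n) g (c i)) \prod_(i < n) p (c i) <=
  expR (- y) * (\sum_v p v * expR (h * g v)) ^+ n.
Proof.
move=> p0.
have -> : (\sum_v p v * expR (h * g v)) ^+ n =
  \sum_(c : {ffun 'I_n -> I}) \prod_(i < n) (p (c i) * expR (h * g (c i))).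
  by rewrite -(bigA_distr_bigA (fun _ v => p v * expR (h * g v))) prodr_const card_ord.
rewrite mulr_sumr [leLHS]big_mkcond /=; apply: ler_sum => c _.
have pc0 : 0 <= \prod_(i < n) p (c i) by exact: prodr_ge0.
rewrite big_split /= -expR_sum -mulr_sumr mulrCA -expRD.
case: ifPn => [H|_]; last by rewrite mulr_ge0 ?expR_ge0.
by rewrite ler_peMr// -expR0 ler_expR addrC subr_ge0.
Qed.

Section coin.
Variables (R : realType) (n : nat).

Let sgn (b : bool) : R := if b then 1 else -1.

(** Tilting the fair coin to the coin of mean [u] for the signs makes the
    event typical; the density costs exactly the Gaussian exponent up to
    factors tending to 1. *)
Lemma coin_lower (u del : R) : 0 < u < 1 -> 0 < del <= 2^-1 ->
  12 <= n%:R * (u ^+ 2 * del ^+ 2) ->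
  expR (- (n%:R * (u ^+ 2 * ((1 + del) / (1 - u) - 2^-1)))) / 2 <=
  \sum_(c : {ffun 'I_n -> bool} | n%:R * u * (1 - del) <= \sum_(i < n) sgn (c i))
    \prod_(i < n) (2^-1 : R).
Proof.
move=> /andP[u0 u1] /andP[d0 d1] nud.
pose p (b : bool) : R := (1 + sgn b * u) / 2.
have p0 b : 0 < p b by rewrite /p /sgn; case: b; lra.
have p0' b : 0 <= p b := ltW (p0 b).
pose q := (1 + u) / 2.
have q01 : 0 <= q <= 1 by rewrite /q; lra.
pose g (b : bool) : R := b%:R - q.
have mgf h : \sum_b p b * expR (h * g b) <= expR (h ^+ 2 * (q * (1 - q)) / 2 * expR `|h|).
  apply: le_trans (bernoulli_mgf h q01); rewrite big_bool /=.
  rewrite /g /p /sgn /= le_eqVlt; apply/orP; left; apply/eqP.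
  congr (_ * _ + _ * expR _); rewrite /q; by field.
have S_g (c : {ffun 'I_n -> bool}) :
    \sum_(i < n) sgn (c i) = n%:R * u + 2 * \sum_(i < n) g (c i).
  rewrite (_ : n%:R * u = \sum_(i < n) u); last by rewrite sumr_const card_ord mulr_natl.
  rewrite mulr_sumr -big_split /=.
  by apply: eq_bigr => i _; rewrite /sgn /g /q; case: (c i) => /=; field.
(* the tilted sum leaves its window with probability at most 1/2 *)
pose h := u * del.
have h0 : 0 < h by rewrite mulr_gt0.
have h1 : h <= 2^-1 by rewrite /h; nra.
have tail s : `|s| = 1 ->
    \sum_(c : {ffun 'I_n -> bool} | n%:R * (h ^+ 2 / 2) <= (s * h) * \sum_(i < n) g (c i))
      \prod_(i < n) p (c i) <= 4^-1.
  move=> s1; apply: le_trans (finite_chernoff _ _ _ _ p0') _.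
  apply: (@le_trans _ _ (expR (- (n%:R * (h ^+ 2 / 2))) * expR (n%:R * (h ^+ 2 / 4)))).
    rewrite ler_wpM2l ?expR_ge0// expRM_natl lerXn2r ?nnegrE ?expR_ge0//.
      by apply: sumr_ge0 => b _; rewrite mulr_ge0 ?expR_ge0.
    apply: le_trans (mgf _) _.
    rewrite normrM s1 mul1r gtr0_norm// exprMn -[s ^+ 2]real_normK ?num_real//.
    rewrite s1 expr1n mul1r ler_expR.
    have e2 : expR h <= 2 by have := @expR_le1D2 _ h; lra.
    have e0 := expR_ge0 h.
    have q4 : q * (1 - q) <= 4^-1 by have := sqr_ge0 (2 * q - 1); nra.
    have q0 : 0 <= q * (1 - q) by nra.
    have := sqr_ge0 h; set H := h ^+ 2 => H0.
    have : q * (1 - q) * expR h <= 4^-1 * 2 by apply: ler_pM.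
    nra.
  rewrite -expRD (_ : - _ + _ = - (n%:R * h ^+ 2 / 4)); last by field.
  have x3 : 3 <= n%:R * h ^+ 2 / 4 by rewrite /h exprMn; lra.
  rewrite expRN lef_pV2 ?posrE ?expR_gt0//; have := expR_ge1Dx (n%:R * h ^+ 2 / 4); lra.
pose win (c : {ffun 'I_n -> bool}) :=
  n%:R * u * (1 - del) <= \sum_(i < n) sgn (c i) <= n%:R * u * (1 + del).
have win_prob : 2^-1 <= \sum_(c | win c) \prod_(i < n) p (c i).
  have tot : \sum_(c : {ffun 'I_n -> bool}) \prod_(i < n) p (c i) = 1.
    rewrite -(bigA_distr_bigA (fun _ => p)) prodr_const card_ord big_bool /p /sgn /=.
    by rewrite (_ : _ + _ = 1) ?expr1n//; field.
  have := tail 1 (normr1 _); have := tail (-1) ltac:(by rewrite normrN1).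
  move=> t1 t2; suff : \sum_(c | ~~ win c) \prod_(i < n) p (c i) <= 2^-1.
    by move: tot; rewrite (bigID win) /=; lra.
  apply: le_trans (_ : 4^-1 + 4^-1 <= _); last by lra.
  apply: le_trans (lerD t1 t2).
  rewrite big_mkcond [X in _ <= X + _]big_mkcond [X in _ <= _ + X]big_mkcond.
  rewrite -big_split; apply: ler_sum => c _ /=.
  have pc0 : 0 <= \prod_(i < n) p (c i) by exact: prodr_ge0.
  rewrite /win S_g; set G := \sum_(i < n) g (c i).
  case: ifPn => [nw|_]; last by apply: addr_ge0; case: ifP.
  have : (n%:R * (h ^+ 2 / 2) <= -1 * h * G) || (n%:R * (h ^+ 2 / 2) <= 1 * h * G).
    move: nw; rewrite negb_and -!ltNge => /orP[H|H]; apply/orP; [left|right].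
      have : 0 <= h * (- G - n%:R * h / 2).
        by apply: mulr_ge0; [exact: ltW|rewrite /h; lra].
      lra.
    have : 0 <= h * (G - n%:R * h / 2).
      by apply: mulr_ge0; [exact: ltW|rewrite /h; lra].
    lra.
  by case/orP => ->; [rewrite lerDl|rewrite lerDr]; case: ifP.
(* the likelihood ratio of the two laws depends on the sum of the signs only *)
pose al := - (ln (1 - u ^+ 2) / 2); pose be := ln ((1 + u) / (1 - u)) / 2.
have ratio b : 2^-1 = p b * expR (al - be * sgn b).
  have pb : 0 < 1 + sgn b * u by rewrite /sgn; case: b; lra.
  have -> : al - be * sgn b = - ln (1 + sgn b * u).
    have u2 : 1 - u ^+ 2 = (1 - u) * (1 + u) by ring.
    have p1 : 1 - u \is Num.pos by rewrite posrE; lra.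
    have p2 : 1 + u \is Num.pos by rewrite posrE; lra.
    rewrite /al /be u2 (lnM p1 p2) (ln_div p2 p1).
    by rewrite /sgn; case: (b); rewrite ?mul1r ?mulN1r; field.
  by rewrite expRN lnK ?posrE// /p; field; rewrite gt_eqF.
(* the second order term of the exponent comes from [al], the first from [be] *)
have al_ge : u ^+ 2 / 2 <= al.
  have := @le_ln1Dx _ (- u ^+ 2); rewrite /al; nra.
have be_le : be <= u / (1 - u).
  have -> : be = ln (1 + 2 * u / (1 - u)) / 2.
    by rewrite /be; congr (ln _ / _); field; lra.
  have x0 : 0 <= 2 * u / (1 - u) by apply: divr_ge0; lra.
  have := @le_ln1Dx _ (2 * u / (1 - u)); lra.
have be_ge : 0 <= be.
  apply: divr_ge0 => //; apply: ln_ge0; rewrite ler_pdivlMr; lra.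
have n_ge : 0 <= n%:R :> R by [].
apply: (@le_trans _ _ (\sum_(c | win c) \prod_(i < n) (2^-1 : R))); last first.
  rewrite [leLHS]big_mkcond [leRHS]big_mkcond /=; apply: ler_sum => c _.
  have q0 : 0 <= \prod_(i < n) (2^-1 : R) by exact: prodr_ge0.
  by rewrite /win; case: (n%:R * u * (1 - del) <= _) => //=; case: ifP.
apply: (@le_trans _ _ (expR (- (n%:R * (u ^+ 2 * ((1 + del) / (1 - u) - 2^-1)))) *
   \sum_(c | win c) \prod_(i < n) p (c i))).
  by rewrite ler_wpM2l ?expR_ge0.
rewrite mulr_sumr; apply: ler_sum => c /andP[S1 S2].
rewrite [leRHS](eq_bigr (fun i => p (c i) * expR (al - be * sgn (c i)))); last by move=> i _; exact: ratio.
rewrite [leRHS]big_split /= [leLHS]mulrC ler_wpM2l//; first exact: prodr_ge0.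
rewrite -expR_sum ler_expR sumrB sumr_const card_ord -mulr_sumr.
set S := \sum_(i < n) _ in S1 S2 *.
have S0 : 0 <= S.
  apply: le_trans S1; apply: mulr_ge0; last by rewrite subr_ge0 (le_trans d1)// invf_le1// ler1n.
  by apply: mulr_ge0 => //; exact: ltW.
have h2 : be * S <= u / (1 - u) * (n%:R * u * (1 + del)) by apply: ler_pM.
have h3 : n%:R * (u ^+ 2 / 2) <= al *+ n by rewrite -[al *+ n]mulr_natl ler_wpM2l.
apply: le_trans (lerB h3 h2).
by rewrite le_eqVlt; apply/orP; left; apply/eqP; field; lra.
Qed.

End coin.

(** The indicators of [X <= 2^-1] are tosses of a fair coin. *)
Lemma half_deviation_lower (R : realType) (P : probability (measurableTypeR R) R)
    (n : nat) (u del : R) : df P 2^-1 = 2^-1 -> (0 < n)%N ->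
  0 < u < 1 -> 0 < del <= 2^-1 -> 12 <= n%:R * (u ^+ 2 * del ^+ 2) ->
  ((expR (- (n%:R * (u ^+ 2 * ((1 + del) / (1 - u) - 2^-1)))) / 2)%:E <=
  prob_pow P n [set x | (u / 2 * (1 - del) <= ecdf x 2^-1 - 2^-1)%R])%E.
Proof.
move=> P2 n0 u01 d01 nud.
pose f (t : measurableTypeR R) : bool := (t <= 2^-1)%R.
have f1 : f @^-1` [set true] = `]-oo, 2^-1]%classic.
  by apply/seteqP; split => t /=; rewrite in_itv.
have f0 : f @^-1` [set false] = `]2^-1, +oo[%classic.
  apply/seteqP; split => t /=; rewrite in_itv /= andbT ltNge /f.
    by move=> ->.
  by move/negbTE.
have mf v : measurable (f @^-1` [set v]).
  by case: v; rewrite ?f1 ?f0; exact: measurable_itv.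
have Pf v : fine (P (f @^-1` [set v])) = 2^-1.
  by case: v; rewrite ?f1 ?f0 ?fine_tail /= -/(df P 2^-1) ?P2//; field.
pose Q (c : {ffun 'I_n -> bool}) :=
  n%:R * u * (1 - del) <= \sum_(i < n) (if c i then 1 else -1 : R).
have -> : [set x : n.-tuple (measurableTypeR R) | u / 2 * (1 - del) <= ecdf x 2^-1 - 2^-1] =
    [set x | Q [ffun i => f (tnth x i)]].
  apply/seteqP; suff H x : (u / 2 * (1 - del) <= ecdf x 2^-1 - 2^-1) =
      Q [ffun i => f (tnth x i)] by split => x /=; rewrite H.
  have n0' : 0 < n%:R :> R by rewrite ltr0n.
  rewrite /Q (_ : \sum_(i < n) _ = 2 * n%:R * (ecdf x 2^-1 - 2^-1)).
    by rewrite (_ : n%:R * u * (1 - del) = 2 * n%:R * (u / 2 * (1 - del)));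
      [rewrite ler_pM2l// mulr_gt0|field].
  have -> : 2 * n%:R * (ecdf x 2^-1 - 2^-1) =
     2 * (\sum_(i < n) ((tnth x i <= 2^-1)%R)%:R) - n%:R :> R.
    by rewrite /ecdf; field; rewrite gt_eqF.
  rewrite (_ : n%:R = \sum_(i < n) (1 : R)); last by rewrite sumr_const card_ord.
  rewrite mulr_sumr -sumrB; apply: eq_bigr => i _; rewrite ffunE /f.
  by case: (_ <= _) => /=; ring.
have [_ ->] := prob_pow_cells P Q mf.
rewrite lee_fin; under eq_bigr do under eq_bigr do rewrite Pf.
exact: coin_lower.
Qed.

(** * The two statistics *)

Section sup_image.
Context {R : realType} {I : Type} (S : set I).
Hypothesis S0 : S !=set0.
Implicit Types f g : I -> R.

Let image_neq0 f : [set f t | t in S] !=set0.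
Proof. by have [t St] := S0; exists (f t), t. Qed.

Lemma sup_image_ge f (M : R) t : (forall s, S s -> f s <= M) -> S t ->
  f t <= sup [set f s | s in S].
Proof.
by move=> fM St; apply: ub_le_sup; [exists M => _ [s Ss <-]; exact: fM|exists t].
Qed.

Lemma sup_image_le f (M : R) : (forall s, S s -> f s <= M) ->
  sup [set f s | s in S] <= M.
Proof. by move=> fM; apply: ge_sup => // _ [s Ss <-]; exact: fM. Qed.

(** Strict inequalities are used throughout because, unlike [c <= sup], they
    are witnessed by a point. *)
Lemma sup_image_gt f (M c : R) : (forall s, S s -> f s <= M) ->
  c < sup [set f s | s in S] <-> exists2 t, S t & c < f t.
Proof.
move=> fM; split=> [/(sup_gt (image_neq0 f))[_ [t St <-] ct]|[t St ct]].
  by exists t.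
exact: lt_le_trans ct (sup_image_ge fM St).
Qed.

Lemma sup_image_dist f g (M c : R) :
  (forall s, S s -> f s <= M) -> (forall s, S s -> g s <= M) ->
  (forall s, S s -> `|f s - g s| <= c) ->
  `|sup [set f s | s in S] - sup [set g s | s in S]| <= c.
Proof.
move=> fM gM fg; rewrite ler_distl; apply/andP; split.
  rewrite lerBlDr; apply: sup_image_le => s Ss.
  have := fg _ Ss; rewrite ler_distl => /andP[H _].
  by apply: le_trans (_ : f s + c <= _); [lra|rewrite lerD2r (sup_image_ge fM)].
apply: sup_image_le => s Ss; have := fg _ Ss; rewrite ler_distl => /andP[_ H].
by apply: le_trans H _; rewrite lerD2r (sup_image_ge gM).
Qed.

End sup_image.

Lemma measurable_fun_gt d (T : measurableType d) (R : realType) (f : T -> R) :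
  (forall c, measurable [set x | c < f x]) -> measurable_fun setT f.
Proof.
move=> mf mD; apply: (measurability _ (RGenOInfty.measurableE R)) => //.
move=> _ [_ [c ->] <-]; rewrite setTI.
rewrite (_ : _ @^-1` _ = [set x | c < f x])//.
by apply/seteqP; split => x /=; rewrite in_itv /= andbT.
Qed.

Section statistics.
Context {R : realType}.
Implicit Types (t c k : R) (h : R -> R).

Lemma ecdf_dist_le1 n (x : n.-tuple (measurableTypeR R)) t :
  0 <= t <= 1 -> `|ecdf x t - t| <= 1.
Proof.
move=> t01; have e0 : 0 <= ecdf x t by rewrite divr_ge0// sumr_ge0.
suff : ecdf x t <= 1 by rewrite ler_norml; lra.
have [n0|n0] := posnP n.
  by rewrite /ecdf (_ : n%:R = 0 :> R) ?n0// invr0 mulr0.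
rewrite ler_pdivrMr ?ltr0n// mul1r (_ : n%:R = \sum_(i < n) (1 : R)).
  by apply: ler_sum => i _; case: (tnth x i <= t).
by rewrite sumr_const card_ord.
Qed.

Lemma trimmed_in01 k t : 0 < k -> k <= t <= 1 - k -> 0 <= t <= 1.
Proof. by move=> k0 tk; lra. Qed.

Lemma trimmed_le k : 0 < k < 2^-1 -> k <= 1 - k.
Proof. by lra. Qed.

Lemma bridge_sd_gt0 k t : 0 < k -> k <= t <= 1 - k -> 0 < Num.sqrt (t * (1 - t)).
Proof. by move=> k0 tk; rewrite sqrtr_gt0; apply: mulr_gt0; lra. Qed.

Lemma bridge_sd_ge k t : 0 < k -> k <= t <= 1 - k -> k <= Num.sqrt (t * (1 - t)).
Proof.
move=> k0 tk; rewrite -[leLHS]gtr0_norm// -sqrtr_sqr ler_wsqrtr//; nra.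
Qed.

Let itv01_neq0 : (`]0, 1[%classic : set R) !=set0.
Proof. by exists 2^-1; rewrite /= in_itv /=; lra. Qed.

Let itvk_neq0 k : k < 2^-1 -> (`[k, 1 - k]%classic : set R) !=set0.
Proof. by move=> k2; exists 2^-1; rewrite /= in_itv /=; lra. Qed.

Lemma supnorm01_gt h (M c : R) : (forall t, 0 <= t <= 1 -> `|h t| <= M) ->
  c < supnorm01 h <-> exists2 t : R, 0 < t < 1 & c < `|h t|.
Proof.
move=> hM; rewrite /supnorm01 (@sup_image_gt _ _ _ itv01_neq0 _ M).
  by split => -[t t01 ct]; exists t => //; move: t01; rewrite /= in_itv.
by move=> t /=; rewrite in_itv /= => t01; apply: hM; lra.
Qed.

Lemma supnorm01_dist h1 h2 (M c : R) :
  (forall t, 0 <= t <= 1 -> `|h1 t| <= M) -> (forall t, 0 <= t <= 1 -> `|h2 t| <= M) ->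
  (forall t, 0 < t < 1 -> `|h1 t - h2 t| <= c) ->
  `|supnorm01 h1 - supnorm01 h2| <= c.
Proof.
move=> h1M h2M h12; apply: (sup_image_dist itv01_neq0 (M := M)) => t;
  rewrite /= in_itv /= => t01.
- by apply: h1M; lra.
- by apply: h2M; lra.
- exact: le_trans (ler_dist_dist _ _) (h12 _ t01).
Qed.

Section weighted.
Variable k : R.
Hypothesis k0 : 0 < k < 2^-1.

Let k_gt0 : 0 < k. Proof. by case/andP: k0. Qed.

Let ratio_le h (M : R) : (forall t, 0 <= t <= 1 -> `|h t| <= M) ->
  forall t, `[k, 1 - k]%classic t -> `|h t| / Num.sqrt (t * (1 - t)) <= M / k.
Proof.
move=> hM t; rewrite /= in_itv /= => tk.
have kpos := k_gt0; have kle := bridge_sd_ge k_gt0 tk; have s0 := bridge_sd_gt0 k_gt0 tk.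
apply: ler_pM; rewrite ?invr_ge0 ?sqrtr_ge0 ?normr_ge0//.
  by apply: hM; lra.
by rewrite lef_pV2 ?posrE.
Qed.

Lemma wsupnorm_ge h (M t : R) : (forall t, 0 <= t <= 1 -> `|h t| <= M) ->
  k <= t <= 1 - k -> `|h t| <= wsupnorm k h * Num.sqrt (t * (1 - t)).
Proof.
move=> hM tk; rewrite -ler_pdivrMr ?(bridge_sd_gt0 k_gt0 tk)//.
apply: (@sup_image_ge _ _ `[k, 1 - k]%classic
  (fun t => `|h t| / Num.sqrt (t * (1 - t))) _ _ (ratio_le hM)).
by rewrite /= in_itv.
Qed.

Lemma wsupnorm_gt h (M c : R) : (forall t, 0 <= t <= 1 -> `|h t| <= M) ->
  c < wsupnorm k h <->
  exists2 t : R, k <= t <= 1 - k & c * Num.sqrt (t * (1 - t)) < `|h t|.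
Proof.
move=> hM; have /andP[_ k2] := k0.
rewrite /wsupnorm (@sup_image_gt _ _ _ (itvk_neq0 k2) _ _ _ (ratio_le hM)).
split => -[t]; rewrite /= ?in_itv /= => tk ct; exists t => //.
  by rewrite -ltr_pdivlMr ?(bridge_sd_gt0 k_gt0 tk).
by rewrite ltr_pdivlMr ?(bridge_sd_gt0 k_gt0 tk).
Qed.

Lemma wsupnorm_dist h1 h2 (M c : R) :
  (forall t, 0 <= t <= 1 -> `|h1 t| <= M) -> (forall t, 0 <= t <= 1 -> `|h2 t| <= M) ->
  (forall t, k <= t <= 1 - k -> `|h1 t - h2 t| <= c * Num.sqrt (t * (1 - t))) ->
  `|wsupnorm k h1 - wsupnorm k h2| <= c.
Proof.
move=> h1M h2M h12; have /andP[_ k2] := k0.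
apply: (sup_image_dist (itvk_neq0 k2) (ratio_le h1M) (ratio_le h2M)) => t.
rewrite /= in_itv /= => tk; have s0 := bridge_sd_gt0 k_gt0 tk.
rewrite -mulrBl normrM (ger0_norm (x := _^-1)) ?invr_ge0 ?(ltW s0)//.
rewrite ler_pdivrMr//; exact: le_trans (ler_dist_dist _ _) (h12 _ tk).
Qed.

End weighted.

Let cvg_id_right (t : R) : (fun s : R => s) s @[s --> t^'+] --> t.
Proof. by apply: cvg_at_right_filter; exact: cvg_id. Qed.

Lemma measurable_KS n : measurable_fun setT (@KS R n).
Proof.
apply: measurable_funM => //; apply: measurable_fun_gt => c.
have -> : [set x : n.-tuple (measurableTypeR R) | c < supnorm01 (fun t => ecdf x t - t)] =
  \bigcup_m [set x | exists2 t : R, m.+2%:R^-1 <= t <= 1 - m.+2%:R^-1 & c < `|ecdf x t - t|].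
  apply/seteqP; split => x /=.
    move/(@supnorm01_gt _ _ _ (ecdf_dist_le1 x)) => [t t01 ct].
    pose e := Num.min t (1 - t); have e0 : 0 < e by rewrite lt_min; lra.
    have [m _ Hm] : exists2 m, True & m.+2%:R^-1 < e.
      exists (Num.bound e^-1) => //; rewrite invf_plt ?posrE ?ltr0n//.
      have := archi_boundP (ltW (_ : 0 < e^-1)); rewrite invr_gt0 => /(_ e0) H.
      by apply: lt_trans H _; rewrite ltr_nat.
    exists m => //; exists t => //; move: Hm; rewrite lt_min; set z := _^-1 => /andP[z1 z2]; apply/andP; split; lra.
  move=> [m _ [t tm ct]]; apply/(@supnorm01_gt _ _ _ (ecdf_dist_le1 x)); exists t => //.
  have : 0 < m.+2%:R^-1 :> R by rewrite invr_gt0 ltr0n.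
  move: tm; set z := _^-1 => ? ?.
  by lra.
apply: bigcupT_measurable => m.
apply: (@measurable_dev_event _ _ _ _ (fun t => t) (fun=> c)).
- have : m.+2%:R^-1 <= 2^-1 :> R by rewrite lef_pV2 ?posrE ?ltr0n// ler_nat.
  by set z := (m.+2%:R)^-1; lra.
- by move=> t _; exact: cvg_id_right.
- by move=> t _; exact: cvg_cst.
Qed.

Lemma measurable_WKS (kappa : nat -> R) n : 0 < kappa n < 2^-1 ->
  measurable_fun setT (@WKS R kappa n).
Proof.
move=> k0.
apply: measurable_funM => //; apply: measurable_fun_gt => c.
have -> : [set x : n.-tuple (measurableTypeR R) |
    c < wsupnorm (kappa n) (fun t => ecdf x t - t)] =
  [set x | exists2 t : R, kappa n <= t <= 1 - kappa n &
    c * Num.sqrt (t * (1 - t)) < `|ecdf x t - t|].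
  by apply/seteqP; split => x /(wsupnorm_gt k0 _ (ecdf_dist_le1 x)).
apply: (@measurable_dev_event _ _ _ _ (fun t => t) (fun t => c * Num.sqrt (t * (1 - t)))).
- by lra.
- by move=> t _; exact: cvg_id_right.
- by move=> t _; apply: cvgM; [exact: cvg_cst|exact: cvg_bridge_sd].
Qed.

Section df01.
Variables (P : probability (measurableTypeR R) R) (F : R -> R).
Hypothesis PF : has_df01 P F.

Lemma df01_in t : 0 < t < 1 -> df P t = F t.
Proof. by move=> t01; rewrite /df (PF.2 t)// in_itv. Qed.

Let mass (B : set R) : measurable B -> `]0, 1[%classic `<=` B -> P B = 1%E.
Proof.
move=> mB sB; apply/eqP; rewrite eq_le probability_le1//= -PF.1.
by rewrite le_measure ?inE//; exact: measurable_itv.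
Qed.

Lemma df01_1 : df P 1 = 1.
Proof.
rewrite /df mass//.
by move=> s /=; rewrite !in_itv /= => /andP[_ /ltW].
Qed.

Lemma df01_0 : df P 0 = 0.
Proof.
have := fine_tail P 0; rewrite mass /=; first by lra.
  exact: measurable_itv.
by move=> s /=; rewrite !in_itv /= andbT => /andP[].
Qed.

End df01.

Lemma uniform_df01 : has_df01 (uniform_prob (@ltr01 R)) (fun t => t).
Proof.
have E (B : set R) : measurable B -> B `<=` `[0, 1]%classic ->
    uniform_prob (@ltr01 R) B = lebesgue_measure B.
  move=> mB B01; rewrite /uniform_prob.
  rewrite (eq_integral (fun=> 1%E)) ?integral_cst ?mul1e//.
  move=> t; rewrite inE => /B01 /=; rewrite in_itv /= /uniform_pdf => ->.
  by rewrite subr0 invr1.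
split.
  apply: etrans (E _ _ _) _; first exact: measurable_itv.
    by apply: subset_itv; rewrite bnd_simp.
  by rewrite lebesgue_measure_itv /= lte01 oppr0 adde0.
move=> t; rewrite in_itv /= => t01.
have H : uniform_prob (@ltr01 R) `]-oo, t]%classic =
    uniform_prob (@ltr01 R) `[0, t]%classic.
  rewrite /uniform_prob integral_uniform_pdf [RHS]integral_uniform_pdf.
  congr (integral _ _ _); apply/seteqP; split => s /=; rewrite !in_itv /=; lra.
apply: etrans H _; apply: etrans (E _ _ _) _; first exact: measurable_itv.
  by apply: subset_itv; rewrite bnd_simp//; lra.
rewrite lebesgue_measure_itv /= lte_fin ifT; last by lra.
by rewrite oppr0 adde0.
Qed.

End statistics.

(** * From tail bounds to limits *)

(** Upper and lower exponential bounds, each with an arbitrarily small loss in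
    the exponent, identify the limit. *)
Lemma slope_limit (R : realType) (p : nat -> \bar R) (v : nat -> R) (c : R) :
  v n @[n --> \oo] --> +oo ->
  (forall e, 0 < e -> \forall n \near \oo, (p n <= (expR (- ((c - e) * v n)))%:E)%E) ->
  (forall e, 0 < e -> \forall n \near \oo, ((expR (- ((c + e) * v n)))%:E <= p n)%E) ->
  ((- (v n)^-1)%:E * lne (p n))%E @[n --> \oo] --> c%:E.
Proof.
move=> vy up lo.
pose f n := - ln (fine (p n)) / v n.
have pE e : 0 < e -> \forall n \near \oo, [/\ p n = (fine (p n))%:E, 0 < v n,
    0 < fine (p n), - ((c + e) * v n) <= ln (fine (p n)) &
    ln (fine (p n)) <= - ((c - e) * v n)].
  move=> e0; have v1 : \forall n \near \oo, 1 <= v n by move/cvgryPge : vy; exact.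
  near=> n.
  have pu : (p n <= (expR (- ((c - e) * v n)))%:E)%E by near: n; exact: up.
  have pl : ((expR (- ((c + e) * v n)))%:E <= p n)%E by near: n; exact: lo.
  have vn : 1 <= v n by near: n.
  have pfin : p n \is a fin_num.
    rewrite fin_numE; apply/andP; split; apply/eqP => E.
      by rewrite E leeNy_eq in pl.
    by rewrite E leye_eq in pu.
  move: pu pl; rewrite -[p n](fineK pfin) !lee_fin => pu pl.
  have r0 : 0 < fine (p n) by apply: lt_le_trans pl; exact: expR_gt0.
  split => //=; first by apply: lt_le_trans vn.
    by rewrite -ler_expR lnK ?posrE.
  by rewrite -ler_expR lnK ?posrE.
have fE : \forall n \near \oo, (f n)%:E = ((- (v n)^-1)%:E * lne (p n))%E.
  have := pE 1 ltr01; apply: filterS => n [pnE v_n r0 _ _].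
  by rewrite pnE lne_EFin// -EFinM /f mulNr mulrC mulNr.
apply: cvg_trans (near_eq_cvg fE) _.
apply: cvg_EFin; first by near=> n.
apply/cvgrPdist_le => e e0; have := pE e e0; apply: filterS => n [_ v_n r0 l1 l2] /=.
rewrite /f distrC ler_distl; apply/andP; split.
  by rewrite ler_pdivlMr//; lra.
by rewrite ler_pdivrMr//; lra.
Unshelve. all: by end_near. Qed.

Lemma cvge0_squeeze (R : realType) (p : nat -> \bar R) :
  (forall n, 0 <= p n)%E ->
  (forall e, 0 < e -> \forall n \near \oo, (p n <= e%:E)%E) ->
  p n @[n --> \oo] --> 0%E.
Proof.
move=> p0 H.
have fE : \forall n \near \oo, (fine (p n))%:E = p n.
  have := H 1 ltr01; apply: filterS => n pn; rewrite fineK// ge0_fin_numE//.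
  exact: le_lt_trans pn (ltry _).
apply: cvg_trans (near_eq_cvg fE) _.
apply: cvg_EFin; first by near=> n.
apply/cvgr0Pnorm_le => e e0; near=> n => /=.
rewrite ger0_norm ?fine_ge0// -lee_fin.
have -> : ((fine (p n))%:E = p n)%E by near: n.
by near: n; exact: H.
Unshelve. all: by end_near. Qed.

(** The window of the tilted coin starts at [w], so the tilt is [2 * w] divided
    by [1 - del]. *)
Lemma half_deviation_ge (R : realType) (P : probability (measurableTypeR R) R)
    (n : nat) (w del : R) : df P 2^-1 = 2^-1 -> (0 < n)%N ->
  0 < del <= 10^-1 -> 0 < w -> 2 * w <= del * (1 - del) -> 3 <= n%:R * w ^+ 2 * del ^+ 2 ->
  ((expR (- (2 * (1 + 12 * del) * (n%:R * w ^+ 2))) / 2)%:E <=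
  prob_pow P n [set x | (w <= ecdf x 2^-1 - 2^-1)%R])%E.
Proof.
move=> P2 n0 /andP[d0 d1] w0 wd nw.
pose u := 2 * w / (1 - del).
have d11 : 0 < 1 - del by lra.
have ud : u <= del by rewrite ler_pdivrMr.
have u0 : 0 < u by rewrite divr_gt0 ?mulr_gt0.
have uE : u * (1 - del) = 2 * w by rewrite /u divfK// gt_eqF.
have uw : 2 * w <= u by nra.
have n0' : 0 < n%:R :> R by rewrite ltr0n.
have u01 : 0 < u < 1 by lra.
have d01 : 0 < del <= 2^-1 by lra.
have wE : u / 2 * (1 - del) = w by lra.
have uw2 : 4 * w ^+ 2 <= u ^+ 2 by nra.
have := @half_deviation_lower _ P n u del P2 n0 u01 d01.
rewrite wE => H; apply: le_trans (H _); last first.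
  apply: (@le_trans _ _ (4 * (n%:R * w ^+ 2 * del ^+ 2))); first by lra.
  rewrite (_ : 4 * _ = n%:R * (4 * w ^+ 2 * del ^+ 2)); last by ring.
  by rewrite ler_wpM2l ?ler0n// ler_wpM2r ?sqr_ge0.
rewrite lee_fin ler_pM2r// ler_expR lerN2.
rewrite [leRHS]mulrCA ler_wpM2l ?ler0n//.
have h1 : (1 + del) / (1 - u) <= 1 + 3 * del by rewrite ler_pdivrMr; nra.
have h2 : (1 + del) / (1 - u) - 2^-1 <= (1 + 6 * del) / 2 by lra.
have h3 : u ^+ 2 * (1 - del) ^+ 2 = 4 * w ^+ 2 by rewrite -exprMn uE; ring.
have h4 : 1 <= (1 + 3 * del) * (1 - del) ^+ 2 by nra.
have h5 : u ^+ 2 <= (1 + 3 * del) * (4 * w ^+ 2).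
  rewrite -h3 mulrCA -[leLHS]mulr1 ler_wpM2l ?sqr_ge0//.
apply: (@le_trans _ _ ((1 + 3 * del) * (4 * w ^+ 2) * ((1 + 6 * del) / 2))).
  apply: ler_pM => //; rewrite ?sqr_ge0//.
  by rewrite subr_ge0 ler_pdivlMr; lra.
have w2 := sqr_ge0 w.
rewrite (_ : _ * _ * _ = 2 * w ^+ 2 * ((1 + 3 * del) * (1 + 6 * del))); last by field.
rewrite (_ : 2 * (1 + 12 * del) * w ^+ 2 = 2 * w ^+ 2 * (1 + 12 * del)); last by ring.
by rewrite ler_wpM2l ?mulr_ge0//; nra.
Qed.

(** The number of geometric blocks, in a form where the constant depends on
    their ratio only. *)
Lemma block_count (R : realType) (eta : R) : 0 < eta -> exists2 C : R, 0 < C &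
  forall kappa, 0 < kappa -> 1 <= ln kappa^-1 -> exists2 J : nat,
    2^-1 <= kappa * (1 + eta) ^+ J & 4 * J%:R <= C * ln kappa^-1.
Proof.
move=> e0; have l0 : 0 < ln (1 + eta) by apply: ln_gt0; lra.
exists (4 * ((ln (1 + eta))^-1 + 1)); first by rewrite mulr_gt0// addr_gt0 ?invr_gt0.
move=> kappa k0; set L := ln kappa^-1 => L1.
pose J := (Num.truncn (L / ln (1 + eta))).+1; exists J.
  have e1 : 0 < 1 + eta by lra.
  have pw : 0 < (1 + eta) ^+ J by exact: exprn_gt0.
  have : kappa^-1 <= (1 + eta) ^+ J.
    rewrite -ler_ln ?posrE ?invr_gt0// lnXn// -mulr_natr mulrC -ler_pdivrMr//.
    apply: ltW; exact: truncnS_gt.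
  rewrite -[_ * _]mulrC -ler_pdivrMr// => H; apply: le_trans H.
  by rewrite ler_piMl ?invr_ge0 ?(ltW k0)// invf_le1// ler1n.
have : 0 <= L / ln (1 + eta) by rewrite divr_ge0 ?(ltW l0)//; lra.
move/truncn_itv => /andP[tL _].
rewrite -mulrA ler_pM2l// mulrDl mul1r mulrC /J -natr1; lra.
Qed.

Lemma weighted_tail_log (R : realType) (eta : R) : 0 < eta <= 8^-1 ->
  exists2 C : R, 0 < C &
  forall (P : probability (measurableTypeR R) R) (n : nat) (kappa w : R),
  (0 < n)%N -> 0 < kappa < 2^-1 -> 1 <= ln kappa^-1 -> 0 < w ->
  w ^+ 2 <= eta ^+ 2 * kappa ->
  (forall t, kappa <= t <= 1 - kappa ->
    `|df P t - t| <= eta * t /\ `|df P t - t| <= eta * (1 - t)) ->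
  (prob_pow P n [set x | exists2 t : R, (kappa <= t <= 1 - kappa)%R &
     (w * Num.sqrt (t * (1 - t)) < `|ecdf x t - df P t|)%R] <=
   (expR (ln (C * ln kappa^-1) - n%:R * (w ^+ 2 / 2 * (1 - 14 * eta))))%:E)%E.
Proof.
move=> e01; have e0 : 0 < eta by case/andP: e01.
have [C C0 HC] := block_count e0; exists C => // P n kappa w n0 k0 L1 w0 wk HF.
have kpos : 0 < kappa by case/andP: k0.
have [J J1 J2] := HC kappa kpos L1.
apply: le_trans (weighted_tail n0 k0 e01 w0 wk HF J1) _.
rewrite lee_fin expRD lnK ?posrE; last by rewrite mulr_gt0//; lra.
by rewrite ler_wpM2r ?expR_ge0.
Qed.

(** * Deviations under the uniform law *)

Section eventually.
Variable R : realType.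
Implicit Types (u : nat -> R) (r : R).

Lemma near_norm_le u r : u n @[n --> \oo] --> (0 : R) -> 0 < r ->
  \forall n \near \oo, `|u n| <= r.
Proof. by move/cvgr0Pnorm_le => H r0; exact: H. Qed.

Lemma near_ge u r : u n @[n --> \oo] --> +oo -> \forall n \near \oo, r <= u n.
Proof. by move/cvgryPge => H; exact: H. Qed.

Lemma ln_cvgy u : u n @[n --> \oo] --> +oo -> ln (u n) @[n --> \oo] --> +oo.
Proof.
move=> uy; apply/cvgryPge => r; have := near_ge (expR r) uy; apply: filterS => n run.
by rewrite -ler_expR lnK// posrE (lt_le_trans _ run)// expR_gt0.
Qed.

Lemma ln_nat_cvgy : ln (n%:R : R) @[n --> \oo] --> +oo.
Proof. exact/ln_cvgy/cvgr_idn. Qed.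

End eventually.

Section null_deviations.
Variable R : realType.
Local Notation P0 := (uniform_prob (@ltr01 R)).

Lemma uniform_df t : 0 <= t <= 1 -> df P0 t = t.
Proof.
move=> t01; have PF := @uniform_df01 R.
have [->|t0] := eqVneq t 0; first exact: df01_0 PF.
have [->|t1] := eqVneq t 1; first exact: df01_1 PF.
apply: (df01_in PF); rewrite !lt_neqAle; move: t01 => /andP[-> ->].
by rewrite eq_sym t0 t1.
Qed.

Let df_half : df P0 2^-1 = 2^-1.
Proof. by apply: uniform_df; lra. Qed.

Lemma measurable_half_event n (w : R) :
  measurable [set x : n.-tuple (measurableTypeR R) | w <= ecdf x 2^-1 - 2^-1].
Proof.
have -> : [set x : n.-tuple (measurableTypeR R) | w <= ecdf x 2^-1 - 2^-1] =
    ~` [set x | - w < (-1) * (ecdf x 2^-1 - 2^-1)].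
  apply/seteqP; split => x /=; rewrite mulN1r ltrN2 => H.
    by apply/negP; rewrite -leNgt.
  by rewrite leNgt; apply/negP.
by apply: measurableC; exact: measurable_dev.
Qed.

Lemma measurable_ge_stat n (T : n.-tuple (measurableTypeR R) -> R) (c : R) :
  measurable_fun setT T -> measurable [set x | c <= T x].
Proof.
move=> mT; rewrite -[X in measurable X]setTI.
have -> : [set x | c <= T x] = T @^-1` `[c, +oo[%classic.
  by apply/seteqP; split => x /=; rewrite in_itv /= andbT.
by apply: mT => //; exact: measurable_itv.
Qed.

(** One fixed point carries the whole probability on the exponential scale:
    the median, where the variance of the empirical process is largest and
    the weight is 2. *)
Lemma null_lower (T : statistic R) (s c : R) (w : nat -> R) : 0 < s -> c = 2 * s ^+ 2 ->
  (forall n, 0 < w n) -> w n @[n --> \oo] --> (0 : R) ->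
  n%:R * w n ^+ 2 @[n --> \oo] --> +oo ->
  (forall n, (0 < n)%N -> measurable_fun setT (T n)) ->
  (forall n (x : n.-tuple (measurableTypeR R)), (0 < n)%N ->
     s * w n <= ecdf x 2^-1 - 2^-1 -> Num.sqrt n%:R * w n <= T n x) ->
  forall e, 0 < e -> \forall n \near \oo,
    ((expR (- ((c + e) * (n%:R * w n ^+ 2))))%:E <=
     prob_pow P0 n [set x | (Num.sqrt n%:R * w n <= T n x)%R])%E.
Proof.
move=> s0 cE w0 wc nwy mT HT e e0.
have c0 : 0 < c by rewrite cE mulr_gt0// exprn_gt0.
pose del := Num.min 10^-1 (e / (24 * c)).
have d0 : 0 < del by rewrite lt_min; apply/andP; split; [lra|apply: divr_gt0 => //; lra].
have d1 : del <= 10^-1 by rewrite /del ge_min lexx.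
have d2 : c * (12 * del) <= e / 2.
  have : del <= e / (24 * c) by rewrite /del ge_min lexx orbT.
  by rewrite ler_pdivlMr ?mulr_gt0//; lra.
near=> n.
have n0 : (0 < n)%N by near: n; exact: nbhs_infty_gt.
have h1 : `|w n| <= del * (1 - del) / (2 * s).
  near: n; apply: near_norm_le => //; apply: divr_gt0; last lra.
  apply: mulr_gt0; lra.
have h2 : 3 / (s ^+ 2 * del ^+ 2) <= n%:R * w n ^+ 2 by near: n; exact: near_ge.
have h3 : ln 2 * (2 / e) <= n%:R * w n ^+ 2 by near: n; exact: near_ge.
have sub : [set x : n.-tuple (measurableTypeR R) | s * w n <= ecdf x 2^-1 - 2^-1] `<=`
    [set x | Num.sqrt n%:R * w n <= T n x] by move=> x /=; exact: HT.
apply: le_trans (le_measure (prob_pow P0 n) _ _ sub); last 2 first.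
- by rewrite inE; exact: measurable_half_event.
- by rewrite inE; apply: measurable_ge_stat; exact: mT.
have d01 : 0 < del <= 10^-1 by rewrite d0.
have sw0 : 0 < s * w n by rewrite mulr_gt0.
apply: le_trans (half_deviation_ge df_half n0 d01 sw0 _ _).
- rewrite lee_fin -[X in _ / X](@lnK R 2) ?posrE// -expRB ler_expR.
  set v := n%:R * w n ^+ 2 in h2 h3 *.
  rewrite (_ : n%:R * (s * w n) ^+ 2 = s ^+ 2 * v); last by rewrite /v; ring.
  have v0 : 0 <= v by rewrite /v mulr_ge0// sqr_ge0.
  have h4 : ln 2 <= e / 2 * v.
    by move: h3; rewrite -[2 / e]invf_div ler_pdivrMr ?divr_gt0// mulrC.
  have h5 := ler_wpM2r v0 d2.
  rewrite (_ : 2 * (1 + 12 * del) * (s ^+ 2 * v) = c * v + c * (12 * del) * v).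
    by lra.
  by rewrite cE; ring.
- move: h1; rewrite gtr0_norm// ler_pdivlMr ?mulr_gt0//; lra.
- move: h2; rewrite ler_pdivrMr; last by rewrite mulr_gt0// exprn_gt0.
  by rewrite (_ : n%:R * (s * w n) ^+ 2 * del ^+ 2 =
    n%:R * w n ^+ 2 * (s ^+ 2 * del ^+ 2)); last ring.
Unshelve. all: by end_near. Qed.

Lemma sqrt_mul_le n (w y : R) : (0 < n)%N ->
  (Num.sqrt n%:R * w <= Num.sqrt n%:R * y) = (w <= y).
Proof. by move=> n0; rewrite ler_pM2l// sqrtr_gt0 ltr0n. Qed.

Lemma KS_null_deviations (w : nat -> R) : (forall n, 0 < w n) -> W_KS w ->
  ((- (n%:R * w n ^+ 2)^-1)%:E *
   lne (prob_pow P0 n [set x | (Num.sqrt n%:R * w n <= KS x)%R]))%E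
  @[n --> \oo] --> 2%:E.
Proof.
move=> w0 [wc nwy]; apply: slope_limit => //; last first.
  apply: (@null_lower (@KS R) 1) => //; first by rewrite expr1n mulr1.
    by move=> n _; exact: measurable_KS.
  move=> n x n0; rewrite mul1r => H; rewrite sqrt_mul_le//; apply: le_trans H _.
  apply: le_trans (ler_norm _) _.
  rewrite leNgt; apply/negP => /lt_le_trans H.
  have := (@supnorm01_gt _ _ _ (supnorm01 (fun t => ecdf x t - t)) (ecdf_dist_le1 x)).2.
  rewrite ltxx => K; apply: notF; apply: K; exists 2^-1; first by lra.
  exact: H.
move=> e e0.
(* the exponent loses the factor [1 - 22 * del], of which [2 * del] is the price
   of a strict inequality; hence the choice [44 * del <= e / 2] *)
pose K := (Num.truncn (44 / e) + 5)%N.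
pose del : R := ((2 * K)%:R)^-1.
have K5 : (5 <= K)%N by rewrite /K leq_addl.
have K0 : 0 < K%:R :> R by rewrite ltr0n (leq_trans _ K5).
have d0 : 0 < del by rewrite invr_gt0 ltr0n muln_gt0 (leq_trans _ K5).
have d1 : del <= 10^-1.
  by rewrite lef_pV2 ?posrE ?ltr0n ?muln_gt0 ?(leq_trans _ K5)// ler_nat (leq_mul2l 2 5).
have d2 : 44 * del <= e / 2.
  have : 44 / e <= K%:R.
    by apply/ltW/(lt_le_trans (truncnS_gt _)); rewrite ler_nat /K -addn1 leq_add2l.
  rewrite ler_pdivrMr// => H; rewrite /del natrM invfM mulrA ler_pdivrMr//; lra.
near=> n.
have n0 : (0 < n)%N by near: n; exact: nbhs_infty_gt.
have h1 : `|w n| <= del ^+ 2 by near: n; apply: near_norm_le => //; exact: exprn_gt0.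
have h3 : ln (4 * K%:R) * (2 / e) <= n%:R * w n ^+ 2 by near: n; exact: near_ge.
pose w' := w n * (1 - del).
have d11 : 0 < 1 - del by lra.
have w'0 : 0 < w' by rewrite mulr_gt0.
have w'w : w' < w n by rewrite /w' -[ltRHS]mulr1 ltr_pM2l//; lra.
have sub : [set x : n.-tuple (measurableTypeR R) | Num.sqrt n%:R * w n <= KS x] `<=`
    [set x | exists2 t : R, 0 <= t <= 1 & w' < `|ecdf x t - df P0 t|].
  move=> x /=; rewrite /KS sqrt_mul_le// => /(lt_le_trans w'w).
  move/(@supnorm01_gt _ _ _ _ (ecdf_dist_le1 x)) => [t t01 H].
  by exists t; [lra|rewrite uniform_df//; lra].
apply: le_trans (le_measure (prob_pow P0 n) _ _ sub) _.
- by rewrite inE; apply: measurable_ge_stat; exact: measurable_KS.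
- rewrite inE; apply: (@measurable_dev_event _ _ _ _ (df P0) (fun=> w')) => //.
  + by move=> t _; exact: df_right.
  + by move=> t _; exact: cvg_cst.
have w'd : 0 < w' <= del ^+ 2.
  by rewrite w'0 (le_trans (ltW w'w))// (le_trans (ler_norm _)).
apply: le_trans (uniform_tail n0 K5 w'd _) _.
  by move=> t t01; rewrite uniform_df// subrr normr0 divr_ge0// ltW.
rewrite lee_fin -/del -[4 * K%:R](@lnK R) ?posrE ?mulr_gt0// -expRD ler_expR.
set v := n%:R * w n ^+ 2 in h3 *.
have v0 : 0 <= v by rewrite /v mulr_ge0// sqr_ge0.
rewrite (_ : n%:R * _ = v * (2 * ((1 - del) ^+ 2 * (1 - 20 * del)))); last first.
  by rewrite /v /w'; ring.
have h4 : ln (4 * K%:R) <= e / 2 * v.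
  by move: h3; rewrite -[2 / e]invf_div ler_pdivrMr ?divr_gt0// [v * _]mulrC.
have h5 : 1 - 22 * del <= (1 - del) ^+ 2 * (1 - 20 * del) by nra.
have h6 := ler_wpM2l v0 h5; have h7 := ler_wpM2r v0 d2.
lra.
Unshelve. all: by end_near. Qed.

End null_deviations.

(** * Deviations of the weighted statistic *)

Section trimming.
Variables (R : realType) (kappa : nat -> R) (l : R).
Hypothesis kappa_bnd : forall n, 0 < kappa n < 2^-1.
Hypothesis l0 : l < 0.
Hypothesis kappa_l : ln (kappa n) / ln n%:R @[n --> \oo] --> l.

Lemma log_kappa_bounds : \forall n \near \oo,
  - l / 2 * ln n%:R <= ln (kappa n)^-1 <= (1 - l) * ln n%:R.
Proof.
have l2 : 0 < Num.min 1 (- l / 2).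
  by rewrite lt_min ltr01 /= divr_gt0 ?oppr_gt0.
near=> n.
have h : `|l - ln (kappa n) / ln n%:R| <= Num.min 1 (- l / 2).
  by near: n; move/cvgrPdist_le : kappa_l; exact.
have ln0 : 1 <= ln n%:R :> R by near: n; apply: near_ge; exact: ln_nat_cvgy.
have lnn0 : 0 < ln n%:R :> R by lra.
have k0 : 0 < kappa n by case/andP: (kappa_bnd n).
rewrite lnV ?posrE//; move: h; rewrite le_min !ler_distl.
set q := ln (kappa n) / ln n%:R.
have -> : ln (kappa n) = q * ln n%:R by rewrite /q divfK// gt_eqF.
move=> /andP[/andP[_ h1] /andP[h2 _]]; apply/andP; split; nra.
Unshelve. all: by end_near. Qed.

Lemma log_kappa_cvgy : ln (kappa n)^-1 @[n --> \oo] --> +oo.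
Proof.
apply/cvgryPge => r; near=> n.
have /andP[h _] : - l / 2 * ln n%:R <= ln (kappa n)^-1 <= (1 - l) * ln n%:R.
  by near: n; exact: log_kappa_bounds.
have l2 : 0 < - l / 2 by rewrite divr_gt0 ?oppr_gt0.
apply: le_trans h; rewrite mulrC -ler_pdivrMr//.
by near: n; apply: near_ge; exact: ln_nat_cvgy.
Unshelve. all: by end_near. Qed.

(** [kappa] is a power of [n] up to lower order, so the two iterated
    logarithms in the hypotheses are interchangeable. *)
Lemma loglog_le : exists2 D : R, 0 < D & \forall n \near \oo,
  ln (ln (kappa n)^-1) <= D + ln (ln n%:R) /\ ln (ln n%:R) <= D + ln (ln (kappa n)^-1).
Proof.
have l2 : 0 < - l / 2 by rewrite divr_gt0 ?oppr_gt0.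
have l1 : 0 < 1 - l by lra.
exists (1 + `|ln (1 - l)| + `|ln (- l / 2)|); first by have := normr_ge0 (ln (1 - l)); have := normr_ge0 (ln (- l / 2)); lra.
near=> n.
have /andP[h1 h2] : - l / 2 * ln n%:R <= ln (kappa n)^-1 <= (1 - l) * ln n%:R.
  by near: n; exact: log_kappa_bounds.
have ln0 : 1 <= ln n%:R :> R by near: n; apply: near_ge; exact: ln_nat_cvgy.
have lk0 : 1 <= ln (kappa n)^-1 by near: n; apply: near_ge; exact: log_kappa_cvgy.
have lnn0 : 0 < ln n%:R :> R by lra.
have lkk0 : 0 < ln (kappa n)^-1 by lra.
have n1 := ler_norm (ln (1 - l)); have n2 := ler_norm (- ln (- l / 2)).
rewrite normrN in n2.
have p1 := normr_ge0 (ln (1 - l)); have p2 := normr_ge0 (ln (- l / 2)).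
split.
  have : ln (ln (kappa n)^-1) <= ln ((1 - l) * ln n%:R).
    by rewrite ler_ln ?posrE// mulr_gt0.
  by rewrite lnM ?posrE//; lra.
have : ln (- l / 2 * ln n%:R) <= ln (ln (kappa n)^-1).
  by rewrite ler_ln ?posrE// mulr_gt0.
by rewrite lnM ?posrE//; lra.
Unshelve. all: by end_near. Qed.

Lemma WKS_null_deviations (w : nat -> R) : (forall n, 0 < w n) -> W_WKS kappa w ->
  ((- (n%:R * w n ^+ 2)^-1)%:E *
   lne (prob_pow (uniform_prob (@ltr01 R)) n
     [set x | (Num.sqrt n%:R * w n <= WKS kappa x)%R]))%E
  @[n --> \oo] --> (2^-1)%:E.
Proof.
move=> w0 [wc wk nwl].
have lly : ln (ln n%:R) @[n --> \oo] --> (+oo : set_system R).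
  exact/ln_cvgy/ln_nat_cvgy.
have nw_ge (A : R) : \forall n \near \oo, A * ln (ln n%:R) <= n%:R * w n ^+ 2.
  near=> n.
  have h1 : 1 <= ln (ln n%:R) :> R by near: n; exact: near_ge.
  have : A <= n%:R * w n ^+ 2 / ln (ln n%:R) by near: n; exact: near_ge.
  by rewrite ler_pdivlMr//; lra.
have nwy : n%:R * w n ^+ 2 @[n --> \oo] --> +oo.
  apply/cvgryPge => r; near=> n.
  have h1 : r <= ln (ln n%:R) :> R by near: n; exact: near_ge.
  apply: le_trans h1 _; rewrite -[leLHS]mul1r; near: n; exact: nw_ge.
have half_itv n : kappa n <= 2^-1 <= 1 - kappa n by have := kappa_bnd n; lra.
apply: slope_limit => //; last first.
  apply: (@null_lower _ (@WKS R kappa) 2^-1) => //; first by field.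
    by move=> n _; exact: measurable_WKS.
  move=> n x n0 H; rewrite sqrt_mul_le//.
  have := wsupnorm_ge (kappa_bnd n) (ecdf_dist_le1 x) (half_itv n).
  rewrite (_ : 2^-1 * (1 - 2^-1) = 2^-1 ^+ 2); last by field.
  rewrite sqrtr_sqr [`|2^-1|]ger0_norm// => Hs.
  rewrite -(@ler_pM2r _ 2^-1)//; apply: le_trans Hs; rewrite mulrC.
  by apply: le_trans H _; exact: ler_norm.
move=> e e0.
(* the exponent loses the factor [1 - 16 * eta], of which [2 * eta] is the price
   of a strict inequality; the other half of [e] absorbs the number of blocks *)
pose eta := Num.min 8^-1 (e / 16).
have eta0 : 0 < eta by rewrite lt_min; apply/andP; split; [lra|apply: divr_gt0].
have eta8 : eta <= 8^-1 by rewrite /eta ge_min lexx.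
have etae : eta <= e / 16 by rewrite /eta ge_min lexx orbT.
have eta01 : 0 < eta <= 8^-1 by rewrite eta0.
have [C C0 HC] := weighted_tail_log eta01.
have [D D0 HD] := loglog_le.
near=> n.
have n0 : (0 < n)%N by near: n; exact: nbhs_infty_gt.
have h1 : `|w n / Num.sqrt (kappa n)| <= eta by near: n; exact: near_norm_le.
have h2 : 1 <= ln (kappa n)^-1 by near: n; apply: near_ge; exact: log_kappa_cvgy.
have [h3 _] : ln (ln (kappa n)^-1) <= D + ln (ln n%:R) /\
  ln (ln n%:R) <= D + ln (ln (kappa n)^-1) by near: n; exact: HD.
have h4 : ln C + D <= ln (ln n%:R) by near: n; exact: near_ge.
have h5 : 4 / e * ln (ln n%:R) <= n%:R * w n ^+ 2 by near: n; exact: nw_ge.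
have /andP[k0 k2] := kappa_bnd n.
pose w' := w n * (1 - eta).
have w'0 : 0 < w' by rewrite mulr_gt0//; lra.
have w'w : w' < w n by rewrite /w' -[ltRHS]mulr1 ltr_pM2l//; lra.
have wk2 : w' ^+ 2 <= eta ^+ 2 * kappa n.
  apply: (@le_trans _ _ (w n ^+ 2)).
    by rewrite lerXn2r ?nnegrE ?(ltW w'w)// ltW.
  have sk0 : 0 < Num.sqrt (kappa n) by rewrite sqrtr_gt0.
  move: h1; rewrite ger0_norm; last by rewrite divr_ge0// ltW.
  rewrite ler_pdivrMr// => h1.
  rewrite -[X in _ * X](sqr_sqrtr (ltW k0)) -exprMn lerXn2r ?nnegrE//.
    exact: ltW.
  by rewrite mulr_ge0// ltW.
pose P0 := uniform_prob (@ltr01 R).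
have sub : [set x : n.-tuple (measurableTypeR R) | Num.sqrt n%:R * w n <= WKS kappa x] `<=`
    [set x | exists2 t : R, kappa n <= t <= 1 - kappa n &
      w' * Num.sqrt (t * (1 - t)) < `|ecdf x t - df P0 t|].
  move=> x /=; rewrite /WKS sqrt_mul_le// => /(lt_le_trans w'w).
  move/(wsupnorm_gt (kappa_bnd n) _ (ecdf_dist_le1 x)) => [t tk H].
  by exists t => //; rewrite uniform_df// (trimmed_in01 k0 tk).
apply: le_trans (le_measure (prob_pow P0 n) _ _ sub) _.
- by rewrite inE; apply: measurable_ge_stat; exact: measurable_WKS.
- rewrite inE; apply: (@measurable_dev_event _ _ _ _ (df P0)
    (fun t => w' * Num.sqrt (t * (1 - t)))).
  + exact: trimmed_le.
  + by move=> t _; exact: df_right.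
  + by move=> t _; apply: cvgM; [exact: cvg_cst|exact: cvg_bridge_sd].
apply: le_trans (HC P0 n (kappa n) w' n0 (kappa_bnd n) h2 w'0 wk2 _) _.
  move=> t tk; have /andP[t0 t1] := trimmed_in01 k0 tk; rewrite -subr_ge0 in t1.
  rewrite uniform_df; last exact: trimmed_in01 tk.
  by rewrite subrr normr0; split; apply: mulr_ge0 => //; exact: ltW.
rewrite lee_fin ler_expR lnM ?posrE//; last exact: lt_le_trans h2.
set v := n%:R * w n ^+ 2 in h5 *.
have v0 : 0 <= v by rewrite /v mulr_ge0// sqr_ge0.
rewrite (_ : n%:R * _ = v * (((1 - eta) ^+ 2 * (1 - 14 * eta)) / 2)); last first.
  by rewrite /v /w'; field.
have h6 : 2 * ln (ln n%:R) <= e / 2 * v.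
  have := ler_wpM2l (_ : 0 <= e / 2) h5; rewrite (_ : e / 2 * (4 / e * _) = 2 * ln (ln n%:R)).
    by apply; lra.
  by field; rewrite gt_eqF.
have h7 : 1 - 16 * eta <= (1 - eta) ^+ 2 * (1 - 14 * eta) by nra.
have h8 := ler_wpM2l v0 h7; have h9 := ler_wpM2r v0 etae.
lra.
Unshelve. all: by end_near. Qed.

End trimming.

(** * Laws of large numbers under the alternatives *)

Lemma sup_image_scale (R : realType) (I : Type) (S : set I) (f : I -> R) (M c : R) :
  S !=set0 -> (forall s, S s -> f s <= M) -> 0 < c ->
  sup [set c * f s | s in S] = c * sup [set f s | s in S].
Proof.
move=> S0 fM c0; apply/eqP; rewrite eq_le; apply/andP; split.
  apply: (sup_image_le S0) => s Ss; rewrite ler_pM2l//.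
  exact: (sup_image_ge fM).
rewrite -ler_pdivlMl//; apply: (sup_image_le S0) => s Ss.
rewrite ler_pdivlMl//.
apply: (@sup_image_ge _ _ S (fun s => c * f s) (c * M)) => // r Sr.
by rewrite ler_pM2l// fM.
Qed.

Lemma measurable_rel_error (R : realType) n (T : n.-tuple (measurableTypeR R) -> R)
    (b eps : R) : measurable_fun setT T -> measurable [set x | eps <= `|T x / b - 1|].
Proof.
move=> mT; apply: (@measurable_ge_stat _ _ (fun x => `|T x / b - 1|)).
apply: measurableT_comp; first exact: normr_measurable.
by apply: measurable_funB => //; exact: measurable_funM.
Qed.

Section alternatives.
Variables (R : realType) (A : R -> R) (theta kappa : nat -> R).
Variable P : nat -> probability (measurableTypeR R) R.
Variable M : R.
Hypothesis A_le : forall t : R, 0 <= t <= 1 -> `|A t| <= M.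
Hypotheses (A_0 : A 0 = 0) (A_1 : A 1 = 0).
Hypothesis theta_01 : forall n, 0 < theta n < 1.
Hypothesis theta_cvg0 : theta n @[n --> \oo] --> (0 : R).
Hypothesis P_df : forall n, has_df01 (P n) (fun t => t + theta n * A t).
Hypothesis kappa_bnd : forall n, 0 < kappa n < 2^-1.

Local Notation m := (fun n => wsupnorm (kappa n) A).
Local Notation N := (supnorm01 A).

Let theta_gt0 n : 0 < theta n. Proof. by case/andP: (theta_01 n). Qed.

Lemma df_alternative n t : 0 <= t <= 1 -> df (P n) t = t + theta n * A t.
Proof.
move=> t01; have PF := P_df n.
have [->|t0] := eqVneq t 0; first by rewrite (df01_0 PF) A_0 mulr0 addr0.
have [->|t1] := eqVneq t 1; first by rewrite (df01_1 PF) A_1 mulr0 addr0.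
apply: (df01_in PF); rewrite !lt_neqAle; move: t01 => /andP[-> ->].
by rewrite eq_sym t0 t1.
Qed.

Let shift_le n t : 0 <= t <= 1 -> `|theta n * A t| <= M.
Proof.
move=> t01; rewrite normrM gtr0_norm//; apply: le_trans (A_le t01).
by rewrite ler_piMl// ltW//; case/andP: (theta_01 n).
Qed.

Let Mmax n (x : n.-tuple (measurableTypeR R)) t : 0 <= t <= 1 ->
  `|ecdf x t - t| <= Num.max 1 M.
Proof. by move=> t01; rewrite le_max ecdf_dist_le1. Qed.

Let shift_le_max n t : 0 <= t <= 1 -> `|theta n * A t| <= Num.max 1 M.
Proof. by move=> t01; rewrite le_max shift_le// orbT. Qed.

Lemma supnorm01_ge t : 0 <= t <= 1 -> `|A t| <= N.
Proof.
have H s : 0 < s < 1 -> `|A s| <= N.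
  move=> s01; apply: (@sup_image_ge _ _ `]0, 1[%classic (fun s => `|A s|) M).
    by move=> r /=; rewrite in_itv /= => r01; apply: A_le; lra.
  by rewrite /= in_itv.
have N0 : 0 <= N by apply: le_trans (H 2^-1 _); [exact: normr_ge0|lra].
move=> t01.
have [->|t0] := eqVneq t 0; first by rewrite A_0 normr0.
have [->|t1] := eqVneq t 1; first by rewrite A_1 normr0.
apply: H; rewrite !lt_neqAle; move: t01 => /andP[-> ->].
by rewrite eq_sym t0 t1.
Qed.

Lemma supnorm01_scale n : supnorm01 (fun t => theta n * A t) = theta n * N.
Proof.
rewrite /supnorm01 -(@sup_image_scale _ _ _ (fun t => `|A t|) M)//.
- congr (sup _); apply/seteqP; split => _ [t t01 <-]; exists t => //;
    by rewrite normrM (gtr0_norm (theta_gt0 n)).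
- by exists 2^-1; rewrite /= in_itv /=; lra.
- by move=> t /=; rewrite in_itv /= => t01; apply: A_le; lra.
Qed.

Lemma wsupnorm_scale n : wsupnorm (kappa n) (fun t => theta n * A t) = theta n * m n.
Proof.
have k0 := kappa_bnd n.
rewrite /wsupnorm -(@sup_image_scale _ _ _ (fun t => `|A t| / Num.sqrt (t * (1 - t)))
  (m n))//.
- congr (sup _); apply/seteqP; split => _ [t t01 <-]; exists t => //;
    by rewrite normrM (gtr0_norm (theta_gt0 n)) mulrA.
- by exists 2^-1; rewrite /= in_itv /=; lra.
- move=> t /=; rewrite in_itv /= => tk.
  by rewrite ler_pdivrMr ?(bridge_sd_gt0 _ tk) ?(wsupnorm_ge k0 A_le tk)//; case/andP: k0.
Qed.

Let rel_error n (S b : R) : (0 < n)%N -> 0 < b ->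
  `|Num.sqrt n%:R * S / (Num.sqrt n%:R * b) - 1| = `|S - b| / b.
Proof.
move=> n0 b0; have s0 : 0 < Num.sqrt n%:R :> R by rewrite sqrtr_gt0 ltr0n.
have -> : Num.sqrt n%:R * S / (Num.sqrt n%:R * b) - 1 = (S - b) / b.
  by field; rewrite !gt_eqF.
by rewrite normrM [`|b^-1|]gtr0_norm ?invr_gt0.
Qed.

(** A fixed number of blocks is enough for a rate of [w ^+ 2], half of the
    optimal one. *)
Lemma KS_lln : 0 < N -> n%:R * theta n ^+ 2 @[n --> \oo] --> +oo ->
  forall eps : R, 0 < eps ->
  prob_pow (P n) n [set x | eps <= `|KS x / (Num.sqrt n%:R * theta n * N) - 1|]
    @[n --> \oo] --> 0%E.
Proof.
move=> N0 nty eps eps0; apply: cvge0_squeeze => [n|e e0]; first exact: measure_ge0.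
have eps2 : eps / 2 < eps by lra.
pose w n : R := eps / 2 * (theta n * N).
(* 20 blocks on each side make [1 - 20 * del] equal to 1/2 *)
pose del : R := ((2 * 20)%:R)^-1.
have delE : del = 40^-1 by [].
have d0 : 0 < del by rewrite invr_gt0 ltr0n.
have epsN : 0 < eps / 2 * N by rewrite mulr_gt0// divr_gt0.
near=> n.
have n0 : (0 < n)%N by near: n; exact: nbhs_infty_gt.
have b0 : 0 < theta n * N by rewrite mulr_gt0.
have w0 : 0 < w n by rewrite /w mulr_gt0// divr_gt0.
have h1 : `|theta n| <= del / 2 / N.
  by near: n; apply: near_norm_le => //; rewrite !divr_gt0.
have h2 : `|theta n| <= del ^+ 2 / (eps / 2 * N).
  by near: n; apply: near_norm_le => //; rewrite divr_gt0// exprn_gt0.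
have h3 : (ln 80 - ln e) / (eps / 2 * N) ^+ 2 <= n%:R * theta n ^+ 2.
  by near: n; exact: near_ge.
rewrite gtr0_norm// in h1; rewrite gtr0_norm// in h2.
have sub : [set x : n.-tuple (measurableTypeR R) |
      eps <= `|KS x / (Num.sqrt n%:R * theta n * N) - 1|] `<=`
    [set x | exists2 t : R, 0 <= t <= 1 & w n < `|ecdf x t - df (P n) t|].
  move=> x /=; rewrite -mulrA /KS rel_error// => H.
  apply: contrapT => Hn; move: H; apply/negP; rewrite -ltNge.
  apply: (@le_lt_trans _ _ (eps / 2)); last exact: eps2.
  rewrite ler_pdivrMr// -supnorm01_scale.
  apply: (supnorm01_dist (@Mmax n x) (@shift_le_max n)) => t t01.
  rewrite leNgt; apply/negP => wt; apply: Hn; exists t; first by lra.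
  rewrite supnorm01_scale in wt; rewrite df_alternative; last by lra.
  by rewrite opprD addrA.
apply: le_trans (le_measure (prob_pow (P n) n) _ _ sub) _.
- by rewrite inE; apply: measurable_rel_error; exact: measurable_KS.
- rewrite inE; apply: (@measurable_dev_event _ _ _ _ (df (P n)) (fun=> w n)) => //.
  + by move=> t _; exact: df_right.
  + by move=> t _; exact: cvg_cst.
have wd : 0 < w n <= del ^+ 2.
  rewrite w0 /= (_ : w n = theta n * (eps / 2 * N)); last by rewrite /w; ring.
  by rewrite -ler_pdivlMr.
apply: le_trans (@uniform_tail _ (P n) n n0 20 (w n) isT wd _) _.
  move=> t t01; rewrite df_alternative// addrAC subrr add0r normrM gtr0_norm//.
  apply: (@le_trans _ _ (theta n * N)).
    by rewrite ler_pM2l// supnorm01_ge.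
  by rewrite -ler_pdivlMr.
rewrite lee_fin -/del delE.
have -> : 4 * 20%:R * expR (- (n%:R * (2 * w n ^+ 2 * (1 - 20 / 40)))) =
    expR (ln 80 - n%:R * w n ^+ 2).
  rewrite expRD lnK ?posrE//; congr (_ * expR _); first by ring.
  by field.
rewrite -[leRHS](@lnK R e) ?posrE// ler_expR.
move: h3; rewrite ler_pdivrMr; last by rewrite exprn_gt0.
have -> : n%:R * theta n ^+ 2 * (eps / 2 * N) ^+ 2 = n%:R * w n ^+ 2.
  by rewrite /w; ring.
by lra.
Unshelve. all: by end_near. Qed.

(** The exponent [n * (theta * m) ^+ 2] beats the logarithm of the number of
    blocks, which is of the order of [ln (ln (kappa n)^-1)]. *)
Lemma WKS_lln : m n @[n --> \oo] --> +oo ->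
  ln (kappa n)^-1 @[n --> \oo] --> +oo ->
  n%:R * theta n ^+ 2 / ln (ln (kappa n)^-1) @[n --> \oo] --> +oo ->
  theta n * m n / Num.sqrt (kappa n) @[n --> \oo] --> (0 : R) ->
  forall eps : R, 0 < eps ->
  prob_pow (P n) n [set x | eps <= `|WKS kappa x / (Num.sqrt n%:R * theta n * m n) - 1|]
    @[n --> \oo] --> 0%E.
Proof.
move=> my ky nty tmk eps eps0; apply: cvge0_squeeze => [n|e e0]; first exact: measure_ge0.
have eps2 : eps / 2 < eps by lra.
pose w n : R := eps / 2 * (theta n * m n).
pose eta : R := 28^-1.
have eta0 : 0 < eta by rewrite invr_gt0.
have eta8 : 0 < eta <= 8^-1 by rewrite eta0 lef_pV2 ?posrE// ler_nat.
have [C C0 HC] := weighted_tail_log eta8.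
near=> n.
have n0 : (0 < n)%N by near: n; exact: nbhs_infty_gt.
have m1 : 1 <= m n by near: n; exact: near_ge.
have k1 : 1 <= ln (kappa n)^-1 by near: n; exact: near_ge.
have lk1 : Num.max 1 (Num.max (ln C) (- ln e)) <= ln (ln (kappa n)^-1).
  by near: n; apply: near_ge; exact: ln_cvgy.
have h1 : `|theta n * m n / Num.sqrt (kappa n)| <= Num.min eta (eta / (eps / 2)).
  by near: n; apply: near_norm_le => //; rewrite lt_min eta0 /= divr_gt0// divr_gt0.
have h2 : 48 / eps ^+ 2 <= n%:R * theta n ^+ 2 / ln (ln (kappa n)^-1).
  by near: n; exact: near_ge.
have [/andP[k0 k2] kb] := (kappa_bnd n, kappa_bnd n).
have m0 : 0 < m n := lt_le_trans ltr01 m1.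
have b0 : 0 < theta n * m n by rewrite mulr_gt0.
have w0 : 0 < w n by rewrite /w mulr_gt0// divr_gt0.
have sk0 : 0 < Num.sqrt (kappa n) by rewrite sqrtr_gt0.
move: h1; rewrite gtr0_norm ?divr_gt0// le_min !ler_pdivrMr// => /andP[h1 h1'].
have tk_le t : kappa n <= t -> t <= 1 -> Num.sqrt (kappa n) * Num.sqrt (t * (1 - t)) <= t.
  move=> kt t1; rewrite -sqrtrM ?(ltW k0)//.
  have t0 : 0 <= t := le_trans (ltW k0) kt.
  rewrite -[leRHS]ger0_norm// -sqrtr_sqr ler_wsqrtr//; nra.
have shift_sd t : kappa n <= t <= 1 - kappa n ->
    `|theta n * A t| <= eta * (Num.sqrt (kappa n) * Num.sqrt (t * (1 - t))).
  move=> tk; rewrite normrM gtr0_norm// mulrA.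
  apply: (@le_trans _ _ (theta n * m n * Num.sqrt (t * (1 - t)))).
    by rewrite -mulrA ler_pM2l// (wsupnorm_ge kb A_le tk).
  by rewrite ler_wpM2r ?sqrtr_ge0.
have shift_t t : kappa n <= t <= 1 - kappa n ->
    `|theta n * A t| <= eta * t /\ `|theta n * A t| <= eta * (1 - t).
  move=> tk; have /andP[tk1 tk2] := tk.
  have /andP[t0 t1] := trimmed_in01 k0 tk.
  have t2 : kappa n <= 1 - t by rewrite lerBrDr addrC -lerBrDr.
  have t3 : 1 - t <= 1 by rewrite lerBlDr lerDl.
  split; apply: le_trans (shift_sd _ tk) _; rewrite ler_pM2l//; first exact: tk_le.
  by rewrite [t * _](_ : _ = (1 - t) * (1 - (1 - t))); [exact: tk_le|ring].
have sub : [set x : n.-tuple (measurableTypeR R) |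
      eps <= `|WKS kappa x / (Num.sqrt n%:R * theta n * m n) - 1|] `<=`
    [set x | exists2 t : R, kappa n <= t <= 1 - kappa n &
      w n * Num.sqrt (t * (1 - t)) < `|ecdf x t - df (P n) t|].
  move=> x /=; rewrite -mulrA /WKS rel_error// => H.
  apply: contrapT => Hn; move: H; apply/negP; rewrite -ltNge.
  apply: (@le_lt_trans _ _ (eps / 2)); last exact: eps2.
  rewrite ler_pdivrMr// -wsupnorm_scale.
  apply: (wsupnorm_dist kb (@Mmax n x) (@shift_le_max n)) => t tk.
  rewrite leNgt; apply/negP => wt; apply: Hn; exists t => //.
  rewrite wsupnorm_scale in wt; rewrite df_alternative; last exact: trimmed_in01 tk.
  by rewrite opprD addrA.
apply: le_trans (le_measure (prob_pow (P n) n) _ _ sub) _.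
- by rewrite inE; apply: measurable_rel_error; exact: measurable_WKS.
- rewrite inE; apply: (@measurable_dev_event _ _ _ _ (df (P n))
    (fun t => w n * Num.sqrt (t * (1 - t)))).
  + exact: trimmed_le.
  + by move=> t _; exact: df_right.
  + by move=> t _; apply: cvgM; [exact: cvg_cst|exact: cvg_bridge_sd].
have wk : w n ^+ 2 <= eta ^+ 2 * kappa n.
  rewrite -[X in _ * X](sqr_sqrtr (ltW k0)) -exprMn lerXn2r ?nnegrE ?(ltW w0)//.
    by rewrite mulr_ge0// ltW.
  move: h1'; rewrite mulrAC ler_pdivlMr ?divr_gt0//.
  by rewrite /w mulrC.
apply: le_trans (HC (P n) n (kappa n) (w n) n0 kb k1 w0 wk _) _.
  move=> t tk; rewrite df_alternative; last exact: trimmed_in01 tk.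
  by rewrite addrAC subrr add0r; exact: shift_t.
rewrite lee_fin -[leRHS](@lnK R e) ?posrE// ler_expR.
have kpos : 0 < ln (kappa n)^-1 := lt_le_trans ltr01 k1.
rewrite lnM ?posrE//.
set L := ln (ln (kappa n)^-1) in lk1 h2 *.
move: lk1; rewrite !ge_max => /and3P[L1 L2 L3].
have L0 : 0 < L := lt_le_trans ltr01 L1.
have h3 : 3 * L <= n%:R * (w n ^+ 2 / 2 * (1 - 14 * eta)).
  have -> : n%:R * (w n ^+ 2 / 2 * (1 - 14 * eta)) =
    eps ^+ 2 / 16 * (n%:R * theta n ^+ 2) * m n ^+ 2.
    by rewrite /w /eta; field.
  move: h2; rewrite ler_pdivlMr// => h2.
  have h4 : 3 * L <= eps ^+ 2 / 16 * (n%:R * theta n ^+ 2).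
    have e2 : 0 <= eps ^+ 2 / 16 by rewrite divr_ge0// sqr_ge0.
    have := ler_wpM2l e2 h2.
    rewrite (_ : eps ^+ 2 / 16 * (48 / eps ^+ 2 * L) = 3 * L)//.
    by field; rewrite gt_eqF.
  apply: le_trans h4 _; rewrite ler_peMr//; last by rewrite exprn_ege1.
  by apply: mulr_ge0; [rewrite divr_ge0// sqr_ge0|rewrite mulr_ge0// sqr_ge0].
lra.
Unshelve. all: by end_near. Qed.

End alternatives.

(** * The efficiency *)

Lemma continuous_bounded01 (R : realType) (A : R -> R) :
  {within `[0, 1], continuous A} ->
  exists M : R, forall t : R, 0 <= t <= 1 -> `|A t| <= M.
Proof.
move=> cA; have [c1 _ H1] := EVT_max ler01 cA; have [c2 _ H2] := EVT_min ler01 cA.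
exists (Num.max (A c1) (- A c2)) => t t01.
have t01' : t \in `[0, 1] by rewrite in_itv.
rewrite ler_norml; apply/andP; split; last by rewrite le_max H1.
by rewrite lerNl le_max lerN2 H2 ?orbT.
Qed.

Lemma cvgry_of_ratio (R : realType) (u L : nat -> R) :
  L n @[n --> \oo] --> +oo -> u n / L n @[n --> \oo] --> +oo ->
  u n @[n --> \oo] --> +oo.
Proof.
move=> Ly uLy; apply/cvgryPge => r; near=> n.
have h1 : Num.max 1 r <= L n by near: n; exact: near_ge.
have h2 : 1 <= u n / L n by near: n; exact: near_ge.
move: h1; rewrite ge_max => /andP[h1 h1']; have h0 : 0 < L n by lra.
by move: h2; rewrite ler_pdivlMr//; lra.
Unshelve. all: by end_near. Qed.

Lemma near_sqrt_cancel (R : realType) (b : nat -> R) :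
  \forall n \near \oo, b n = Num.sqrt n%:R * b n / Num.sqrt n%:R.
Proof.
near=> n; have n0 : (0 < n)%N by near: n; exact: nbhs_infty_gt.
by rewrite mulrAC divff ?mul1r// gt_eqF// sqrtr_gt0 ltr0n.
Unshelve. all: by end_near. Qed.

Theorem corollary1 (R : realType) (A : R -> R) (theta kappa t_ : nat -> R)
    (P : nat -> probability (measurableTypeR R) R)
    (A_cont : {within `[0, 1], continuous A})
    (A_0 : A 0 = 0) (A_1 : A 1 = 0)
    (A_neq0 : exists t : R, t \in `[0, 1] /\ A t <> 0)
    (theta_01 : forall n, 0 < theta n < 1)
    (theta_cvg0 : theta n @[n --> \oo] --> (0 : R))
    (P_df : forall n, has_df01 (P n) (fun t => t + theta n * A t))
    (kappa_bnd : forall n, 0 < kappa n < 2^-1)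
    (kappa_cvg0 : kappa n @[n --> \oo] --> (0 : R))
    (t_itv : forall n, kappa n <= t_ n <= 1 - kappa n)
    (t_max : forall n,
      `|A (t_ n)| / Num.sqrt (t_ n * (1 - t_ n)) = wsupnorm (kappa n) A)
    (m_cvgy : wsupnorm (kappa n) A @[n --> \oo] --> +oo)
    (t_cvg : t_ n @[n --> \oo] --> (0 : R) \/ t_ n @[n --> \oo] --> (1 : R))
    (kappa_liminf :
      (0 < limn_einf (fun n => (n%:R * kappa n / ln n%:R ^+ 2)%:E))%E)
    (kappa_lim : exists2 l : R,
      l < 0 & ln (kappa n) / ln n%:R @[n --> \oo] --> l)
    (theta_large :
      n%:R * theta n ^+ 2 / ln (ln (kappa n)^-1) @[n --> \oo] --> +oo)
    (theta_small :
      theta n ^+ 2 * wsupnorm (kappa n) A ^+ 2 / kappa n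
      @[n --> \oo] --> (0 : R)) :
  has_weak_intermediate_efficiency (uniform_prob (@ltr01 R)) P
    (WKS kappa) (W_WKS kappa) (2^-1)
      (fun n => Num.sqrt n%:R * theta n * wsupnorm (kappa n) A)
    (@KS R) (@W_KS R) 2
      (fun n => Num.sqrt n%:R * theta n * supnorm01 A)
    +oo%E
  /\ (wsupnorm (kappa n) A ^+ 2 / (4 * supnorm01 A ^+ 2))%:E
       @[n --> \oo] --> +oo%E.
Proof.
have [M A_le] := continuous_bounded01 A_cont.
have [l l0 kappa_l] := kappa_lim.
have [s [s01 As]] := A_neq0.
pose N := supnorm01 A.
have N0 : 0 < N.
  apply: (@lt_le_trans _ _ `|A s|); first by rewrite normr_gt0; exact/eqP.
  by apply: (supnorm01_ge A_le A_0 A_1); move: s01; rewrite in_itv.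
have Lky := log_kappa_cvgy kappa_bnd l0 kappa_l.
have LLky := ln_cvgy Lky.
have nty : n%:R * theta n ^+ 2 @[n --> \oo] --> +oo.
  exact: cvgry_of_ratio LLky theta_large.
have theta_gt0 n : 0 < theta n by case/andP: (theta_01 n).
have m_sqy : wsupnorm (kappa n) A ^+ 2 / (4 * N ^+ 2) @[n --> \oo] --> +oo.
  apply/cvgryPge => r; near=> n.
  have h : Num.max 1 (r * (4 * N ^+ 2)) <= wsupnorm (kappa n) A by near: n; exact: near_ge.
  move: h; rewrite ge_max => /andP[h1 h2].
  rewrite ler_pdivlMr; last by rewrite mulr_gt0// exprn_gt0.
  by apply: le_trans h2 _; rewrite expr2 ler_peMl//; lra.
have tmk : theta n * wsupnorm (kappa n) A / Num.sqrt (kappa n) @[n --> \oo] --> (0 : R).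
  apply/cvgr0Pnorm_le => e e0; near=> n.
  have h : `|theta n ^+ 2 * wsupnorm (kappa n) A ^+ 2 / kappa n| <= e ^+ 2.
    by near: n; apply: near_norm_le => //; exact: exprn_gt0.
  have k0 : 0 <= kappa n by apply: ltW; case/andP: (kappa_bnd n).
  rewrite -(@ler_pXn2r _ 2)// ?nnegrE ?(ltW e0)//.
  rewrite real_normK ?num_real// !exprMn exprVn sqr_sqrtr//.
  exact: le_trans (ler_norm _) h.
have tm0 : theta n * wsupnorm (kappa n) A @[n --> \oo] --> (0 : R).
  apply/cvgr0Pnorm_le => e e0; near=> n.
  have h : `|theta n * wsupnorm (kappa n) A / Num.sqrt (kappa n)| <= e.
    by near: n; exact: near_norm_le.
  have /andP[k0 k2] := kappa_bnd n.
  have sk0 : 0 < Num.sqrt (kappa n) by rewrite sqrtr_gt0.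
  have sk1 : Num.sqrt (kappa n) <= 1 by rewrite -[leRHS]sqrtr1 ler_wsqrtr//; lra.
  move: h; rewrite normrM [`|_^-1|]gtr0_norm ?invr_gt0// ler_pdivrMr// => h.
  by apply: le_trans h _; rewrite ler_piMr// ltW.
have slope_WKS : has_intermediate_slope (uniform_prob (@ltr01 R)) P
    (WKS kappa) (W_WKS kappa) (2^-1)
    (fun n => Num.sqrt n%:R * theta n * wsupnorm (kappa n) A).
  have nearE := near_sqrt_cancel (fun n => theta n * wsupnorm (kappa n) A).
  split.
  - by rewrite invr_gt0.
  - by move=> w w0 Ww; exact: (WKS_null_deviations kappa_bnd l0 kappa_l).
  - exact: (WKS_lln A_le A_0 A_1 theta_01 P_df kappa_bnd m_cvgy Lky theta_large tmk).
  split.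
  - apply: cvg_trans tm0; apply: near_eq_cvg.
    by apply: filterS nearE => n ->; rewrite mulrA.
  - apply: cvg_trans tmk; apply: near_eq_cvg.
    by apply: filterS nearE => n {1}->; rewrite !mulrA.
  - have [D D0 HD] := loglog_le kappa_bnd l0 kappa_l.
    apply/cvgryPge => r; near=> n.
    have E : theta n * wsupnorm (kappa n) A =
      Num.sqrt n%:R * (theta n * wsupnorm (kappa n) A) / Num.sqrt n%:R by near: n.
    rewrite -[_ * theta n * _]mulrA -E.
    have [_ h1] : ln (ln (kappa n)^-1) <= D + ln (ln n%:R) /\
      ln (ln n%:R) <= D + ln (ln (kappa n)^-1) by near: n; exact: HD.
    have h2 : Num.max 1 D <= ln (ln (kappa n)^-1) by near: n; exact: near_ge.
    have h3 : 1 <= wsupnorm (kappa n) A by near: n; exact: near_ge.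
    have h4 : 2 * `|r| <= n%:R * theta n ^+ 2 / ln (ln (kappa n)^-1).
      by near: n; exact: near_ge.
    have h5 : 1 <= ln (ln n%:R) :> R.
      by near: n; apply: near_ge; exact/ln_cvgy/ln_nat_cvgy.
    move: h2; rewrite ge_max => /andP[h2 h2'].
    move: h4; rewrite ler_pdivlMr; last by lra.
    move=> h4; rewrite ler_pdivlMr; last by lra.
    apply: (@le_trans _ _ (n%:R * theta n ^+ 2)); last first.
      by rewrite exprMn [leRHS]mulrA ler_peMr ?exprn_ege1// mulr_ge0// sqr_ge0.
    apply: le_trans h4; rewrite mulrC mulrAC -mulrA.
    apply: (@le_trans _ _ (ln (ln n%:R) * `|r|)).
      by rewrite ler_wpM2l ?ler_norm//; lra.
    rewrite [leRHS]mulrCA [leRHS]mulrA mulrC; rewrite [leRHS]mulrC.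
    by rewrite ler_wpM2l//; lra.
have slope_KS : has_intermediate_slope (uniform_prob (@ltr01 R)) P
    (@KS R) (@W_KS R) 2 (fun n => Num.sqrt n%:R * theta n * N).
  have nearE := near_sqrt_cancel (fun n => theta n * N).
  split => //.
  - by move=> w w0 Ww; exact: KS_null_deviations.
  - exact: (KS_lln A_le A_0 A_1 theta_01 theta_cvg0 P_df N0 nty).
  split.
  - apply/cvgr0Pnorm_le => e e0; near=> n.
    have E : theta n * N = Num.sqrt n%:R * (theta n * N) / Num.sqrt n%:R by near: n.
    rewrite -[_ * theta n * _]mulrA -E.
    have h : `|theta n| <= e / N by near: n; apply: near_norm_le => //; exact: divr_gt0.
    by rewrite normrM (gtr0_norm N0) -ler_pdivlMr.
  - apply/cvgryPge => r; near=> n.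
    have E : theta n * N = Num.sqrt n%:R * (theta n * N) / Num.sqrt n%:R by near: n.
    rewrite -[_ * theta n * _]mulrA -E exprMn mulrA -ler_pdivrMr ?exprn_gt0//.
    by near: n; exact: near_ge.
have ratioE : \forall n \near \oo, wsupnorm (kappa n) A ^+ 2 / (4 * N ^+ 2) =
    (2^-1 * (Num.sqrt n%:R * theta n * wsupnorm (kappa n) A) ^+ 2) /
    (2 * (Num.sqrt n%:R * theta n * N) ^+ 2).
  near=> n; have n0 : (0 < n)%N by near: n; exact: nbhs_infty_gt.
  have s0 : 0 < Num.sqrt n%:R :> R by rewrite sqrtr_gt0 ltr0n.
  by field; rewrite !gt_eqF.
split; last by apply/cvgeryP; exact: m_sqy.
split => //; apply/cvgeryP; apply: cvg_trans m_sqy; exact: near_eq_cvg.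
Unshelve. all: by end_near. Qed.
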